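(* Let $n\geq 4$. The space $$ZD_{2^n-4n+4}(A_n)=\{x\in A_n : \|x\|=1,\ \dim_{\mathbb{R}}(\operatorname{Ann} x)=2^n-4n+4\},$$ with the subspace topology from the real vector space $A_n\cong\mathbb{R}^{2^n}$, is homeomorphic to a disjoint union of $2^{n-4}$ copies of the Stiefel variety $V_2(\mathbb{R}^7)$, i.e., the space of ordered pairs of orthonormal vectors in $\mathbb{R}^7$.
   Context: The Cayley-Dickson algebras $A_n$ are the finite-dimensional, generally non-associative, real algebras with linear involution $x\mapsto x^*$ defined inductively: $A_0=\mathbb{R}$ with trivial involution, and $A_n = A_{n-1}\times A_{n-1}$ additively, with multiplication $(a,b)(c,d) = (ac - d^* b,\ da + bc^* )$ and involution $(a,b)^* = (a^*,-b)$. Thus $\dim_{\mathbb{R}} A_n = 2^n$. The real part of $x$ is $\operatorname{Re}(x)=(x+x^* )/2\in\mathbb{R}$; the real inner product on $A_n$ is $\langle x,y\rangle=\operatorname{Re}(xy^* )$ (the standard inner product under $A_n\cong\mathbb{R}^{2^n}$), and $\|x\|=\sqrt{\langle x,x\rangle}$. For $x\in A_n$, $\operatorname{Ann} x=\{y\in A_n : xy=0\}$. *)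

(* Defs.v *)
From HB Require Import structures.
From mathcomp Require Import all_boot all_order all_algebra.
From mathcomp Require Import all_classical all_reals all_analysis.

Set Implicit Arguments.
Unset Strict Implicit.
Unset Printing Implicit Defensive.

Import Order.TTheory GRing.Theory Num.Theory numFieldNormedType.Exports.
Local Open Scope ring_scope.
Local Open Scope classical_set_scope.

#[short(type="normedVectType")]
HB.structure Definition NormedVect (R : numFieldType) :=
  {V of Vector R V & NormedModule R V}.
HB.instance Definition _ (K : numFieldType) := NormedModule.on K^o.
HB.instance Definition _ (K : numFieldType) (V W : normedVectType K) :=
  NormedModule.on (V * W)%type.

(* The library norm `|_| on this iterated product is the max norm: it is only
   used as a source of the product topology. The Euclidean norm is [cdnorm]. *)
Fixpoint CD (R : realType) (n : nat) : normedVectType R :=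
  if n is m.+1 then (CD R m * CD R m)%type : normedVectType R
  else (R^o : normedVectType R).

Section CayleyDickson.
Variable R : realType.

Fixpoint cdconj n : CD R n -> CD R n :=
  match n with
  | 0 => fun x => x
  | m.+1 => fun x => (cdconj x.1, - x.2)
  end.

Fixpoint cdmul n : CD R n -> CD R n -> CD R n :=
  match n with
  | 0 => fun x y => (x : R) * (y : R)
  | m.+1 => fun x y =>
      (cdmul x.1 y.1 - cdmul (cdconj y.2) x.2,
       cdmul y.2 x.1 + cdmul x.2 (cdconj y.1))
  end.

(* The embedding of the base field as the line spanned by the unit. *)
Fixpoint cdreal n (r : R) : CD R n :=
  match n return CD R n with
  | 0 => r
  | m.+1 => (cdreal m r, 0)
  end.

Fixpoint cdcoord0 n : CD R n -> R :=
  match n return CD R n -> R with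
  | 0 => fun x => x
  | m.+1 => fun x => cdcoord0 x.1
  end.

(* (x + x^* ) / 2 lies on the real line (see [cdReE]); [cdcoord0] reads it off
   as an element of R. *)
Definition cdRe n (x : CD R n) : R := cdcoord0 (2^-1 *: (x + cdconj x)).

Definition cdinner n (x y : CD R n) : R := cdRe (cdmul x (cdconj y)).

Definition cdnorm n (x : CD R n) : R := Num.sqrt (cdinner x x).

Lemma cdReE n (x : CD R n) : 2^-1 *: (x + cdconj x) = cdreal n (cdRe x).
Proof.
rewrite /cdRe; elim: n x => [//|n IHn] [a b].
congr pair; first exact: IHn.
by rewrite -[LHS]/(2^-1 *: (b - b)) subrr scaler0.
Qed.

Lemma cdconj_linear n : linear (@cdconj n).
Proof.
elim: n => [//|n IHn] k [a b] [c d].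
by congr pair; [exact: IHn | rewrite /= opprD scalerN].
Qed.
HB.instance Definition _ n :=
  GRing.isLinear.Build R (CD R n) (CD R n) _ (@cdconj n) (@cdconj_linear n).

Lemma cdmulS n (a b c d : CD R n) :
  @cdmul n.+1 (a, b) (c, d) =
  (cdmul a c - cdmul (cdconj d) b, cdmul d a + cdmul b (cdconj c)).
Proof. by []. Qed.

Lemma cdmul_bilinear n :
  (forall x, linear (@cdmul n x)) * (forall y, linear ((@cdmul n)^~ y)).
Proof.
have mix (V : lmodType R) (k : R) (x y z t : V) :
    (k *: x + y) + (k *: z + t) = k *: (x + z) + (y + t).
  by rewrite scalerDr addrACA.
elim: n => [|n [IHl IHr]].
  split=> x k y z; first by rewrite /= mulrDr -scalerAr.
  by rewrite /= mulrDl -scalerAl.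
split=> [[a b]|[c d]] k [u v] [w z];
  rewrite -[k *: (u, v) + (w, z)]/(k *: u + w, k *: v + z) !cdmulS.
- by congr pair; rewrite linearP /= ?IHl ?IHr ?opprD -?scalerN mix.
- by congr pair; rewrite /= ?IHl ?IHr ?opprD -?scalerN mix.
Qed.
HB.instance Definition _ n x := GRing.isLinear.Build R (CD R n) (CD R n) _
  (@cdmul n x) ((@cdmul_bilinear n).1 x).

Definition Ann n (x : CD R n) : {vspace CD R n} := lker (linfun (cdmul x)).

Lemma mem_Ann n (x y : CD R n) : (y \in Ann x) = (cdmul x y == 0).
Proof. by rewrite memv_ker lfunE. Qed.

Definition ZD (k n : nat) : set (CD R n) :=
  [set x | cdnorm x = 1 /\ \dim (Ann x) = k].

Definition dotv m (u v : 'rV[R]_m) : R := \sum_(i < m) u ord0 i * v ord0 i.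

Definition Stiefel2 m : set ('rV[R]_m * 'rV[R]_m) :=
  [set p | [/\ dotv p.1 p.1 = 1, dotv p.2 p.2 = 1 & dotv p.1 p.2 = 0]].

End CayleyDickson.

Arguments ZD : clear implicits.
Arguments Stiefel2 : clear implicits.

Definition homeomorphic (X Y : topologicalType) : Prop :=
  exists (f : X -> Y) (g : Y -> X),
    [/\ continuous f, continuous g, cancel f g & cancel g f].

(* Main.v *)
From HB Require Import structures.
Require Import Defs.
From mathcomp Require Import all_boot all_order all_algebra.
From mathcomp Require Import all_classical all_reals all_analysis.
From mathcomp Require Import ring lra zify.

Import numFieldNormedType.Exports.

(** Write A_n for [CD R n], i for the element (0, 1) of A_n, and d_n for
    2^n - 4n + 4. Call an element of A_n doubly pure when it is orthogonal to 1
    and to i. The theorem holds because, for n >= 4, an element of A_(n+1) has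
    an annihilator of dimension d_(n+1) exactly when it is (p, i p) or
    (p, - i p) for some p in A_n whose annihilator has dimension d_n
    ([ZD_double], [ZD_halve]). Each dimension thus doubles the space of zero
    divisors: the new space consists of two disjoint copies of the old one,
    embedded by linear maps. At n = 4 there is a single copy of the Stiefel
    variety, because a nonzero sedenion (a, b) is a zero divisor exactly when a
    and b are orthogonal imaginary octonions of the same length
    ([ZD_sedenionP]).

    The reason for the doubling is a splitting of the product. The entries of a
    zero divisor are imaginary ([zd_imag]). On doubly pure elements, and modulo
    the plane spanned by 1 and i, the product satisfies
    u (i v) = (i u) v = - i (u v) ([dmulJr], [dmulJl]). Consequently the
    coordinates p + i q and p - i q of a pair (p, q) turn the product of
    A_(n+1) into two independent copies of the product of A_n ([split_mul]).

    Let (p, q) be a nonzero element of A_(n+1) with imaginary entries, and let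
    a = p + i q and b = p - i q. If p or q has a component along i, the two
    coordinates of an annihilated pair of doubly pure elements determine each
    other, and the annihilator has dimension less than 2^n ([dim_Ann_tilted]).
    Otherwise, if a and b are both nonzero, its dimension is at most dim Ann a
    + dim Ann b + 6 ([dim_Ann_split]). By induction dim Ann a and dim Ann b are
    at most d_n, and in both cases the annihilator of (p, q) has dimension less
    than d_(n+1). There remains the case where a or b vanishes, that is (p, i
    p) or (p, - i p); there the dimension is exactly dim Ann p + 2^n - 4
    ([dim_Ann_half]), and d_(n+1) = d_n + 2^n - 4.

    For the topology, all the maps involved are restrictions of continuous maps
    between the ambient vector spaces, and the copy that contains a given zero
    divisor is selected among finitely many by closed conditions; this makes
    the choice locally constant ([homeomorphic_sheets]). *)

Set Implicit Arguments.
Unset Strict Implicit.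
Unset Printing Implicit Defensive.

Import Order.TTheory GRing.Theory Num.Theory.
Local Open Scope ring_scope.

Local Notation "x *c y" := (cdmul x y) (at level 40, left associativity).
Local Notation "x ^c" := (cdconj x) (at level 1, format "x ^c").

(** * Multiplication, conjugation and the inner product *)

Section Algebra.
Variable R : realType.

Lemma cdmulDr n (x y z : CD R n) : x *c (y + z) = x *c y + x *c z.
Proof. exact: linearD. Qed.
Lemma cdmulNr n (x y : CD R n) : x *c (- y) = - (x *c y).
Proof. exact: linearN. Qed.
Lemma cdmulZr n k (x y : CD R n) : x *c (k *: y) = k *: (x *c y).
Proof. exact: linearZ. Qed.
Lemma cdmul0r n (x : CD R n) : x *c 0 = 0.
Proof. exact: linear0. Qed.
Lemma cdmulPl n k (x y z : CD R n) : (k *: x + y) *c z = k *: (x *c z) + y *c z.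
Proof. exact: (cdmul_bilinear R n).2. Qed.
Lemma cdmulDl n (x y z : CD R n) : (x + y) *c z = x *c z + y *c z.
Proof. by have := cdmulPl 1 x y z; rewrite !scale1r. Qed.
Lemma cdmul0l n (x : CD R n) : 0 *c x = 0.
Proof. by have := cdmulPl (-1) 0 0 x; rewrite !scaleN1r oppr0 addr0 addNr. Qed.
Lemma cdmulZl n k (x y : CD R n) : (k *: x) *c y = k *: (x *c y).
Proof. by have := cdmulPl k x 0 y; rewrite cdmul0l !addr0. Qed.
Lemma cdmulNl n (x y : CD R n) : (- x) *c y = - (x *c y).
Proof. by rewrite -[- x]scaleN1r cdmulZl scaleN1r. Qed.

Definition cdmulE := (cdmulDr, cdmulDl, cdmulNr, cdmulNl, cdmulZr, cdmulZl, cdmul0r, cdmul0l).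

Lemma cdpair n (x : CD R n.+1) : x = (x.1, x.2) :> CD R n.+1.
Proof. by case: x. Qed.
Lemma cdpairD n (a b c d : CD R n) :
  ((a, b) : CD R n.+1) + ((c, d) : CD R n.+1) = (a + c, b + d).
Proof. by []. Qed.
Lemma cdpairN n (a b : CD R n) : - ((a, b) : CD R n.+1) = (- a, - b).
Proof. by []. Qed.
Lemma cdpairZ n k (a b : CD R n) :
  k *: ((a, b) : CD R n.+1) = (k *: a, k *: b).
Proof. by []. Qed.

Definition cd1 n : CD R n := cdreal n 1.

Lemma cdconjK n : involutive (@cdconj R n).
Proof. by elim: n => [//|n IH] [a b] /=; rewrite IH opprK. Qed.
Lemma cdconjD n (x y : CD R n) : (x + y)^c = x^c + y^c.
Proof. exact: linearD. Qed.
Lemma cdconjN n (x : CD R n) : (- x)^c = - x^c.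
Proof. exact: linearN. Qed.
Lemma cdconjZ n k (x : CD R n) : (k *: x)^c = k *: x^c.
Proof. exact: linearZ. Qed.
Lemma cdconj1 n : (cd1 n)^c = cd1 n.
Proof. by elim: n => //= n IH; rewrite /cd1 /= -/(cd1 n) IH oppr0. Qed.

Lemma cdconjM n (x y : CD R n) : (x *c y)^c = y^c *c x^c.
Proof.
elim: n x y => [x y|n IH [a b] [c d]]; first exact: (mulrC (x : R)).
rewrite cdmulS /= cdmulE !cdconjD !cdconjN !IH !cdconjK !cdmulE opprK opprD.
by rewrite (addrC (- _)).
Qed.

Lemma cdmul1 n (x : CD R n) : (cd1 n *c x = x) * (x *c cd1 n = x).
Proof.
elim: n x => [x|n IH [a b]]; first by split; rewrite /= ?mul1r ?mulr1.
rewrite /cd1 /= -/(cd1 n) !cdmulE cdconj1 !IH !(linear0 (@cdconj R n)) !cdmulE.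
by split; congr pair; rewrite ?addr0 ?add0r ?subr0.
Qed.

(** The Euclidean inner product computed on coordinates; [cdinnerE] identifies
    it with [cdinner]. *)
Fixpoint ip n : CD R n -> CD R n -> R :=
  match n with
  | 0 => fun x y => (x : R) * (y : R)
  | m.+1 => fun x y => ip x.1 y.1 + ip x.2 y.2
  end.

Lemma ipC n (x y : CD R n) : ip x y = ip y x.
Proof. by elim: n x y => [x y|n IH [a b] [c d]] /=; rewrite 1?mulrC // !(IH c) (IH b). Qed.
Lemma ipDr n (x y z : CD R n) : ip x (y + z) = ip x y + ip x z.
Proof.
elim: n x y z => [x y z|n IH [a b] [c d] [e f]] /=; first by rewrite mulrDr.
by rewrite !IH addrACA.
Qed.
Lemma ipZr n k (x y : CD R n) : ip x (k *: y) = k * ip x y.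
Proof.
elim: n x y => [x y|n IH [a b] [c d]] /=; first by rewrite mulrCA.
by rewrite !IH mulrDr.
Qed.
Lemma ipNr n (x y : CD R n) : ip x (- y) = - ip x y.
Proof. by rewrite -scaleN1r ipZr mulN1r. Qed.
Lemma ip0r n (x : CD R n) : ip x 0 = 0.
Proof. by rewrite -[X in ip x X](scale0r (0 : CD R n)) ipZr mul0r. Qed.
Lemma ipDl n (x y z : CD R n) : ip (y + z) x = ip y x + ip z x.
Proof. by rewrite !(ipC _ x) ipDr. Qed.
Lemma ipZl n k (x y : CD R n) : ip (k *: y) x = k * ip y x.
Proof. by rewrite !(ipC _ x) ipZr. Qed.
Lemma ipNl n (x y : CD R n) : ip (- y) x = - ip y x.
Proof. by rewrite !(ipC _ x) ipNr. Qed.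
Lemma ip0l n (x : CD R n) : ip 0 x = 0.
Proof. by rewrite ipC ip0r. Qed.
Definition ipE := (ipDr, ipDl, ipNr, ipNl, ipZr, ipZl, ip0r, ip0l).

Lemma ip_ge0 n (x : CD R n) : 0 <= ip x x.
Proof. by elim: n x => [x|n IH [a b]] /=; rewrite ?addr_ge0 // -expr2 sqr_ge0. Qed.
Lemma ip_eq0 n (x : CD R n) : (ip x x == 0) = (x == 0).
Proof.
elim: n x => [x|n IH [a b]] /=; first by rewrite mulf_eq0 orbb.
rewrite paddr_eq0 ?ip_ge0 // !IH.
by rewrite -[RHS]/((a == 0) && (b == 0)).
Qed.

Lemma ip_conj n (x y : CD R n) : ip x^c y = ip x y^c.
Proof.
elim: n x y => [//|n IH [a b] [c d]] /=.
by rewrite IH ipNl ipNr.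
Qed.

Lemma ip_conj2 n (x y : CD R n) : ip x^c y^c = ip x y.
Proof. by rewrite ip_conj cdconjK. Qed.

(** Reduces an identity of vectors to identities of real numbers, which are in
    reach of [ring] and [lra]. *)
Lemma ip_ext n (x y : CD R n) : (forall z, ip x z = ip y z) -> x = y.
Proof.
move=> h; apply/eqP; rewrite -subr_eq0 -ip_eq0 !ipE.
by rewrite (h x) (h y) subrr opprK addNr addr0.
Qed.

(** Equivalent to Re((x y) z) = Re(x (y z)), the part of associativity that
    survives in every A_n. *)
Lemma ip_adj n (x y z : CD R n) :
  (ip (x *c y) z = ip y (x^c *c z)) * (ip (x *c y) z = ip x (z *c y^c)).
Proof.
elim: n x y z => [x y z|n IH [a b] [c d] [e f]].
  by split => /=; ring.
have hb (u v w : CD R n) : ip (u *c v) w = ip v (u^c *c w) by rewrite (IH u v w).1.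
have hd (u v w : CD R n) : ip (u *c v) w = ip u (w *c v^c) by rewrite (IH u v w).2.
have e1 : ip (d^c *c b) e = ip d (b *c e^c).
  by rewrite hb cdconjK ipC hd ipC.
have e2 : ip (d^c *c b) e = ip b (d *c e) by rewrite hb cdconjK.
have e3 : ip (b *c c^c) f = ip c (f^c *c b).
  by rewrite -ip_conj2 cdconjM cdconjK hd cdconjK.
have e4 : ip (b *c c^c) f = ip b (f *c c) by rewrite hd cdconjK.
rewrite cdmulS; split => /=; rewrite !cdmulE ?cdconjN ?cdconjK ?cdmulE !ipE.
  rewrite (hb a c) (hd d a) e1 e3.
  lra.
rewrite (hd a c) (hb d a) e2 e4.
lra.
Qed.

End Algebra.

Local Notation one := (cd1 _ _).

Section Conjugation.
Variable R : realType.

Lemma cdconj0 n : (0 : CD R n)^c = 0.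
Proof. exact: linear0. Qed.

Lemma cdconjE n (x : CD R n) : x^c = (2 * ip one x) *: one - x.
Proof.
elim: n x => [x|n IH [a b]].
  by apply/eqP; rewrite /= /Defs.CD eq_sym subr_eq /= mul1r /GRing.scale /= mulr1 -mulr2n mulr_natl.
by congr pair; rewrite /= ?ip0l ?addr0 ?IH // scaler0 sub0r.
Qed.

Lemma imag_conj n (x : CD R n) : ip one x = 0 -> x^c = - x.
Proof. by move=> h; rewrite cdconjE h mulr0 scale0r sub0r. Qed.

Lemma mul_conj n (x : CD R n) :
  (x *c x^c = ip x x *: one) * (x^c *c x = ip x x *: one).
Proof.
elim: n x => [x|n IH [a b]].
  by split => /=; rewrite /GRing.scale /= mulr1.
rewrite !cdmulS /= cdconjN cdconjK !cdmulE !IH opprK.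
by split; rewrite -?scalerDl -?scaleNr; congr pair; rewrite ?scaler0 ?addNr ?scaleNr ?subrr // opprK scalerDl.
Qed.

Lemma ip11 n : ip one (one : CD R n) = 1.
Proof. by elim: n => [|n IH] /=; rewrite ?mulr1 // IH ip0r addr0. Qed.
Lemma one_neq0 n : (one : CD R n) != 0.
Proof. by rewrite -ip_eq0 ip11 oner_eq0. Qed.

Lemma ip1M n (x y : CD R n) : ip one (x *c y) = ip x y^c.
Proof. by rewrite ipC (ip_adj _ _ _).2 cdmul1. Qed.

Lemma cdinnerE n (x y : CD R n) : cdinner x y = ip x y.
Proof.
have ip1 z : ip (one : CD R n) z = cdcoord0 z.
  by elim: n z {x y} => [z|n IH [a b]] /=; rewrite ?mul1r // IH ip0l addr0.
rewrite /cdinner /cdRe -ip1 ipZr ipDr -{2}[one]cdconj1 ip_conj2.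
by rewrite ip1M cdconjK; field.
Qed.

Lemma sq_imag n (x : CD R n) : ip one x = 0 -> x *c x = - (ip x x *: one).
Proof. by move=> h; rewrite -(mul_conj x).1 imag_conj // cdmulE opprK. Qed.

Lemma anticomm n (x y : CD R n) : ip one x = 0 -> ip one y = 0 -> ip x y = 0 ->
  y *c x = - (x *c y).
Proof.
move=> hx hy hxy; rewrite -[y *c x]cdconjK cdconjM (imag_conj hx) (imag_conj hy) !cdmulE opprK.
by rewrite cdconjE ip1M imag_conj // ipNr hxy oppr0 mulr0 scale0r sub0r.
Qed.

End Conjugation.

(** * Zero divisors have imaginary halves *)

Section ZeroDivisors.
Variable R : realType.

(** With i = (0, 1), the inner product of x y with y is Re(p) |y|^2, and that of
    x y with i y is Re(q) |y|^2. *)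
Lemma zd_imag n (p q : CD R n) (y : CD R n.+1) :
  ((p, q) : CD R n.+1) *c y = 0 -> y != 0 -> ip one p = 0 /\ ip one q = 0.
Proof.
case: y => c d; rewrite cdmulS => h y0.
have n0 : ip c c + ip d d != 0 by rewrite (ip_eq0 ((c, d) : CD R n.+1)).
have h1 : p *c c - d^c *c q = 0 by move: h => [].
have h2 : d *c p + q *c c^c = 0 by move: h => [].
split; apply/eqP; rewrite -(mulrI_eq0 _ (mulfI n0)); apply/eqP.
  have e1 : ip (p *c c - d^c *c q) c + ip (d *c p + q *c c^c) d = 0.
    by rewrite h1 h2 !ip0l addr0.
  rewrite !ipE in e1.
  have f1 : ip (p *c c) c = ip c c * ip one p.
    by rewrite (ip_adj _ _ _).2 mul_conj ipZr ipC.
  have f2 : ip (d *c p) d = ip d d * ip one p.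
    by rewrite (ip_adj _ _ _).1 mul_conj ipZr ipC.
  have f3 : ip (d^c *c q) c = ip (q *c c^c) d.
    by rewrite (ip_adj _ _ _).1 (ip_adj q _ _).2 !cdconjK.
  rewrite mulrDl -f1 -f2; lra.
(* The pair (- d^c, c^c) is i y. *)
have e1 : ip (p *c c - d^c *c q) (- d^c) + ip (d *c p + q *c c^c) c^c = 0.
  by rewrite h1 h2 !ip0l addr0.
rewrite !ipE in e1.
have f1 : ip (d^c *c q) d^c = ip d d * ip one q.
  by rewrite (ip_adj _ _ _).1 cdconjK mul_conj ipZr ipC.
have f2 : ip (q *c c^c) c^c = ip c c * ip one q.
  by rewrite (ip_adj _ _ _).2 cdconjK mul_conj ipZr ipC.
have f3 : ip (d *c p) c^c = ip (p *c c) d^c.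
  by rewrite (ip_adj _ _ _).1 (ip_adj p _ _).2.
rewrite mulrDl -f1 -f2; lra.
Qed.

(** Follows from [zd_imag] because conjugation exchanges the two factors. *)
Lemma zd_imag_r n (x : CD R n.+1) (c d : CD R n) :
  x *c ((c, d) : CD R n.+1) = 0 -> x != 0 -> ip one c = 0 /\ ip one d = 0.
Proof.
move=> h x0.
have h' : ((c^c, - d) : CD R n.+1) *c x^c = 0.
    by rewrite -[(c^c, - d)]/(((c, d) : CD R n.+1)^c) -cdconjM h cdconj0.
have x0' : x^c != 0.
  by apply: contra x0 => /eqP e; rewrite -[x]cdconjK e cdconj0.
have [e1 e2] := zd_imag h' x0'.
split; first by rewrite -e1 -{2}[one]cdconj1 ip_conj2.
by apply/eqP; rewrite -oppr_eq0 -ipNr e2.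
Qed.

End ZeroDivisors.

(** * Doubly pure elements and the complex structure *)

Section DoublyPure.
Variable R : realType.

Definition impart n (x : CD R n) : CD R n := x - ip one x *: one.
Lemma impartD n (x y : CD R n) : impart (x + y) = impart x + impart y.
Proof. by apply: ip_ext => z; rewrite /impart !ipE; ring. Qed.
Lemma impartN n (x : CD R n) : impart (- x) = - impart x.
Proof. by apply: ip_ext => z; rewrite /impart !ipE; ring. Qed.
Lemma impart_id n (x : CD R n) : ip one x = 0 -> impart x = x.
Proof. by rewrite /impart => ->; rewrite scale0r subr0. Qed.
Lemma impart_conj n (x : CD R n) : impart x^c = - impart x.
Proof. by rewrite /impart cdconjE !ipE ip11; apply: ip_ext => z; rewrite !ipE; ring. Qed.
Lemma impart_mulC n (x y : CD R n) : ip one x = 0 -> ip one y = 0 ->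
  impart (y *c x) = - impart (x *c y).
Proof.
move=> hx hy; rewrite -impart_conj cdconjM !imag_conj // !cdmulE opprK //.
Qed.

(** Left multiplication by i = (0, 1) on doubly pure elements, see [mul_cdi]. The
    formula makes sense on all of A_(n+1) and is linear with square - 1. *)
Definition J n (x : CD R n.+1) : CD R n.+1 := (x.2, - x.1).
(** Orthogonality to 1 and to i = (0, 1). *)
Definition pure2 n (x : CD R n.+1) := ip one x.1 = 0 /\ ip one x.2 = 0.
Definition dpart n (x : CD R n.+1) : CD R n.+1 := (impart x.1, impart x.2).
(** The product modulo the plane spanned by 1 and i: discarding that component
    is what makes [dmulC], [dmulJr] and [dmulJl] hold without correction terms. *)
Definition dmul n (u v : CD R n.+1) := dpart (u *c v).

Lemma JD n (x y : CD R n.+1) : J (x + y) = J x + J y.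
Proof. by case: x y => [a b] [c d]; congr pair; rewrite /= opprD. Qed.
Lemma JN n (x : CD R n.+1) : J (- x) = - J x.
Proof. by case: x. Qed.
Lemma JZ n k (x : CD R n.+1) : J (k *: x) = k *: J x.
Proof. by case: x => a b; congr pair; rewrite /= scalerN. Qed.
Lemma JJ n (x : CD R n.+1) : J (J x) = - x.
Proof. by case: x. Qed.
Lemma ipJ n (x y : CD R n.+1) : ip (J x) y = - ip x (J y).
Proof. by rewrite /= !ipE; ring. Qed.
Lemma ipJJ n (x y : CD R n.+1) : ip (J x) (J y) = ip x y.
Proof. by rewrite /= !ipE; ring. Qed.
Lemma pure2J n (x : CD R n.+1) : pure2 x -> pure2 (J x).
Proof. by case=> h1 h2; split; rewrite //= ipNr h1 oppr0. Qed.
Lemma pure2D n (x y : CD R n.+1) : pure2 x -> pure2 y -> pure2 (x + y).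
Proof. by move=> [h1 h2] [k1 k2]; split; rewrite /= ipDr ?h1 ?k1 ?h2 ?k2 addr0. Qed.
Lemma pure2N n (x : CD R n.+1) : pure2 x -> pure2 (- x).
Proof. by move=> [h1 h2]; split; rewrite /= ipNr ?h1 ?h2 oppr0. Qed.
Lemma pure2_imag n (x : CD R n.+1) : pure2 x -> ip one x = 0.
Proof. by case: x => a b [h1 h2] /=; rewrite h1 ip0l addr0. Qed.
Lemma pure2_conj n (x : CD R n.+1) : pure2 x -> x^c = - x.
Proof. by move=> h; apply/imag_conj/pure2_imag. Qed.
Lemma dpart_id n (x : CD R n.+1) : pure2 x -> dpart x = x.
Proof. by case: x => a b [h1 h2]; congr pair; rewrite /= impart_id. Qed.
Lemma dpartD n (x y : CD R n.+1) : dpart (x + y) = dpart x + dpart y.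
Proof. by rewrite /dpart !impartD. Qed.
Lemma dpartN n (x : CD R n.+1) : dpart (- x) = - dpart x.
Proof. by rewrite /dpart !impartN. Qed.
Lemma dmulDl n (x y z : CD R n.+1) : dmul (x + y) z = dmul x z + dmul y z.
Proof. by rewrite /dmul cdmulE dpartD. Qed.
Lemma dmulDr n (x y z : CD R n.+1) : dmul z (x + y) = dmul z x + dmul z y.
Proof. by rewrite /dmul cdmulE dpartD. Qed.
Lemma dmulNl n (x y : CD R n.+1) : dmul (- x) y = - dmul x y.
Proof. by rewrite /dmul cdmulE dpartN. Qed.
Lemma dmulNr n (x y : CD R n.+1) : dmul x (- y) = - dmul x y.
Proof. by rewrite /dmul cdmulE dpartN. Qed.

Lemma dmulC n (u v : CD R n.+1) : pure2 u -> pure2 v -> dmul v u = - dmul u v.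
Proof.
case: u v => [u1 u2] [v1 v2] [/= h1 h2] [/= k1 k2].
rewrite /dmul !cdmulS /dpart /= !impartD !impartN !(imag_conj h2) !(imag_conj k2) !(imag_conj h1) !(imag_conj k1).
rewrite !cdmulE !impartN cdpairN (impart_mulC k1 h1) (impart_mulC k2 h2).
by congr pair; apply: ip_ext => z; rewrite !ipE; ring.
Qed.

(** Left multiplication by a doubly pure element is conjugate-linear for the
    complex structure [J]; the splitting [split_mul] rests on this. *)
Lemma dmulJr n (u v : CD R n.+1) : pure2 u -> pure2 v -> dmul u (J v) = - J (dmul u v).
Proof.
case: u v => [u1 u2] [v1 v2] [/= h1 h2] [/= k1 k2].
rewrite /dmul /J /= !cdmulE !cdconjN.
rewrite /dpart /= !impartD !impartN !(imag_conj k2) !(imag_conj k1).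
rewrite !cdmulE !impartN cdpairN (impart_mulC k2 h1) (impart_mulC k1 h2) (impart_mulC k2 h2) (impart_mulC k1 h1).
by congr pair; apply: ip_ext => z; rewrite !ipE; ring.
Qed.

Lemma dmulJl n (u v : CD R n.+1) : pure2 u -> pure2 v -> dmul (J u) v = - J (dmul u v).
Proof.
move=> hu hv; rewrite dmulC //; last exact: pure2J.
by rewrite dmulJr // dmulC // JN !opprK.
Qed.

(** Up to sign, the components of u v along 1 and i are the inner products of u
    with v and with J v. *)
Lemma pure2_mul n (u v : CD R n.+1) : pure2 u -> pure2 v -> ip u v = 0 -> ip u (J v) = 0 ->
  pure2 (u *c v).
Proof.
case: u v => [u1 u2] [v1 v2] [/= h1 h2] [/= k1 k2] e1 e2.
split => /=; rewrite ipDr ?ipNr !ip1M.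
  rewrite (imag_conj k1) (imag_conj k2) (imag_conj h2) !ipE (ipC v2).
  by move: e1 => /=; lra.
rewrite cdconjK (imag_conj h1) !ipE (ipC v2).
by move: e2; rewrite /= !ipE; lra.
Qed.

End DoublyPure.

(** * Orthogonal complements *)

Section Complements.
Variable R : realType.

(** Evaluates [linfun] on a function whose linearity is only a hypothesis. *)
Lemma linfunE (aT rT : vectType R) (f : aT -> rT) (lf : linear f) x :
  linfun f x = f x.
Proof.
pose F : {linear aT -> rT} := HB.pack f (GRing.isLinear.Build R aT rT _ f lf).
exact: (lfunE F x).
Qed.

Lemma ip_linear n (u : CD R n) : linear (ip u : CD R n -> R^o).
Proof. by move=> k x y; rewrite !ipE. Qed.

Definition perp n (u : CD R n) (V : {vspace CD R n}) : {vspace CD R n} :=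
  (V :&: lker (linfun (ip u : CD R n -> R^o)))%VS.

Lemma mem_perp n (u : CD R n) (V : {vspace CD R n}) x : (x \in perp u V) = (x \in V) && (ip u x == 0).
Proof. by rewrite memv_cap memv_ker (linfunE (ip_linear u)). Qed.

Lemma dim_perp_ge n (u : CD R n) (V : {vspace CD R n}) : (\dim V <= (\dim (perp u V)).+1)%N.
Proof.
rewrite -(limg_ker_dim (linfun (ip u : CD R n -> R^o)) V) -addn1 leq_add2l.
by apply: leq_trans (dimvS (subvf _)) _; rewrite dimvf.
Qed.

Lemma dim_perp n (u : CD R n) (V : {vspace CD R n}) : u \in V -> u != 0 ->
  \dim V = (\dim (perp u V)).+1.
Proof.
move=> uV u0; apply/eqP; rewrite eqn_leq dim_perp_ge /=.
rewrite -(limg_ker_dim (linfun (ip u : CD R n -> R^o)) V) -addn1 leq_add2l.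
rewrite lt0n dimv_eq0; apply/eqP => e.
have : linfun (ip u : CD R n -> R^o) u \in (linfun (ip u : CD R n -> R^o) @: V)%VS.
  exact: memv_img.
by rewrite e memv0 (linfunE (ip_linear u)) ip_eq0 (negPf u0).
Qed.

Lemma dim_CD n : \dim {: CD R n} = (2 ^ n)%N.
Proof.
rewrite dimvf; elim: n => [//|n IH].
rewrite -[LHS]/(vector.dim (CD R n) + vector.dim (CD R n))%N IH.
by rewrite expnS; lia.
Qed.

Definition orthv n (s : seq (CD R n)) : {vspace CD R n} := foldr (@perp n) fullv s.

Lemma mem_orthv n (s : seq (CD R n)) x :
  (x \in orthv s) = all (fun u => ip u x == 0) s.
Proof. by elim: s => [|u s IH] /=; rewrite ?memvf // mem_perp IH andbC. Qed.

(** Each vector of the list lies in the orthogonal complement of those after it,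
    so it lowers the dimension by exactly one. *)
Lemma dim_orthv n (s : seq (CD R n)) :
  pairwise (fun u v => ip u v == 0) s -> all (fun u => u != 0) s ->
  (\dim (orthv s) + size s = 2 ^ n)%N.
Proof.
elim: s => [|u s IH] /=; first by rewrite addn0 dim_CD.
move=> /andP[h1 h2] /andP[u0 s0].
rewrite -(IH h2 s0) (@dim_perp _ u (orthv s)) // ?addSnnS //.
by rewrite mem_orthv; apply: sub_all h1 => v; rewrite ipC.
Qed.

End Complements.

(** * Splitting the product of the doubled algebra *)

Section Splitting.
Variable R : realType.

Definition cdi n : CD R n.+1 := (0, one).

Lemma mul_cdi n (c : CD R n.+1) : pure2 c -> (cdi n *c c = J c) * (c *c cdi n = - J c).
Proof.
case: c => c1 c2 [/= h1 h2].
split; rewrite /= ?cdconj0 ?cdconj1 ?cdmulE ?cdmul1 ?(imag_conj h1) ?(imag_conj h2) ?cdmulE.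
  by congr pair; rewrite ?sub0r ?opprK ?addr0.
by congr pair; rewrite /= ?sub0r ?addr0 ?opprK.
Qed.

Lemma imag_split n (p : CD R n.+1) : ip one p = 0 ->
  p = ip one p.2 *: cdi n + dpart p.
Proof.
case: p => p1 p2 /=; rewrite ip0l addr0 => h.
rewrite /cdi cdpairZ cdpairD /= scaler0 add0r impart_id //.
by congr pair; rewrite /impart addrC subrK.
Qed.

Lemma pure2_dpart n (p : CD R n.+1) : pure2 (dpart p).
Proof. by split; rewrite /= /impart !ipE ip11; ring. Qed.

Lemma dpartZ n k (x : CD R n.+1) : dpart (k *: x) = k *: dpart x.
Proof. by congr pair; apply: ip_ext => z; rewrite /= /impart !ipE; ring. Qed.
Lemma dpart0 n : dpart (0 : CD R n.+1) = 0.
Proof. by rewrite -[X in dpart X](scale0r (0 : CD R n.+1)) dpartZ scale0r. Qed.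

Lemma cdpair0 n (x y : CD R n) : ((x, y) : CD R n.+1) = 0 -> x = 0 /\ y = 0.
Proof. by case. Qed.

(** In the coordinates a = p + J q, b = p - J q of the left factor and
    x = c + J d, y = c - J d of the right factor, the doubly pure part of the
    product is (a x, b y). The components s and t along i add terms that exchange
    the two coordinates. *)
Lemma split_mul n (s t : R) (p q c d : CD R n.+1) :
  pure2 p -> pure2 q -> pure2 c -> pure2 d ->
  ((s *: cdi n + p, t *: cdi n + q) : CD R n.+2) *c ((c, d) : CD R n.+2) = 0 ->
  dmul (p + J q) (c + J d) + (s *: J (c - J d) + t *: (c - J d)) = 0 /\
  dmul (p - J q) (c - J d) + (s *: J (c + J d) - t *: (c + J d)) = 0.
Proof.
move=> Dp Dq Dc Dd.
rewrite cdmulS !cdmulE (pure2_conj Dc) (pure2_conj Dd) !cdmulE !mul_cdi // => h.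
have [DJc DJd] := (pure2J Dc, pure2J Dd).
have [h1 h2] := cdpair0 h.
have {}h1 := congr1 (@dpart R n) h1.
have {}h2 := congr1 (@dpart R n) h2.
rewrite !(dpartD, dpartN, dpartZ) ?dpartN !(dpart_id DJc) !(dpart_id DJd) dpart0 in h1 h2.
rewrite -![dpart (_ *c _)]/(dmul _ _) in h1 h2.
rewrite !(dmulDl, dmulDr, dmulNl, dmulNr) !dmulJr ?dmulJl //; try exact: pure2J.
rewrite (dmulC Dq Dd) in h1; rewrite (dmulC Dp Dd) in h2.
have {}h2 := congr1 (@J R n) h2.
rewrite !(JD, JN, JZ, JJ) in h2 *.
have J0 : J (0 : CD R n.+1) = 0 by congr pair; rewrite oppr0.
rewrite J0 in h2.
move: (J c) (J d) (dmul p c) (dmul q d) (J (dmul p d)) (J (dmul q c)) h1 h2 => Jc Jd x y z w h1 h2.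
by split; apply: ip_ext => v; have := congr1 (@ip R _ ^~ v) h1; have := congr1 (@ip R _ ^~ v) h2; rewrite !ipE; lra.
Qed.

End Splitting.

(** * Elements with small annihilator *)

Section SmallAnnihilators.
Variable R : realType.

Lemma zd_pure2 n (x y : CD R n.+1) : x *c y = 0 -> y != 0 -> pure2 x.
Proof. by case: x => a b; exact: zd_imag. Qed.
Lemma zd_pure2_r n (x y : CD R n.+1) : x *c y = 0 -> x != 0 -> pure2 y.
Proof. by case: y => a b; exact: zd_imag_r. Qed.

Definition pure2v n : {vspace CD R n.+1} := orthv [:: one; cdi R n].

Lemma ip_cdi n (x : CD R n.+1) : ip (cdi R n) x = ip one x.2.
Proof. by rewrite /= ip0l add0r. Qed.

Lemma pure2vP n (x : CD R n.+1) : reflect (pure2 x) (x \in pure2v n).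
Proof.
rewrite mem_orthv /= !ip0l addr0 add0r andbT.
by apply: (iffP andP) => [[/eqP h1 /eqP h2]|[-> ->]].
Qed.

Lemma dim_pure2v n : (\dim (pure2v n) + 2 = 2 ^ n.+1)%N.
Proof.
apply: (@dim_orthv R n.+1 [:: one; cdi R n]).
  by rewrite /= ip0r ip0l addr0 eqxx.
apply/and3P; split=> //; first exact: one_neq0.
by rewrite -ip_eq0 ip_cdi ip11 oner_eq0.
Qed.

Lemma dmul_linear n (a : CD R n.+1) : linear (dmul a).
Proof. by move=> k x y; rewrite /dmul cdmulE dpartD cdmulE dpartZ. Qed.

(** The coordinates x allowed by the equation a x = 0 of [split_mul]. *)
Definition ker_dmul n (a : CD R n.+1) : {vspace CD R n.+1} :=
  (pure2v n :&: lker (linfun (dmul a)))%VS.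

Lemma ker_dmulP n (a x : CD R n.+1) : reflect (pure2 x /\ dmul a x = 0) (x \in ker_dmul a).
Proof.
rewrite memv_cap memv_ker (linfunE (@dmul_linear n a)).
by apply: (iffP andP) => [[/pure2vP ? /eqP]|[/pure2vP ? /eqP]].
Qed.

(** If the doubly pure part of a x vanishes, then a x lies in the plane spanned
    by 1 and i; two more linear equations on x make it vanish. *)
Lemma dim_ker_dmul n (a : CD R n.+1) : (\dim (ker_dmul a) <= \dim (Ann a) + 2)%N.
Proof.
set u := a^c *c one; set v := a^c *c cdi R n.
have h : (perp u (perp v (ker_dmul a)) <= Ann a)%VS.
  apply/subvP => x; rewrite (mem_perp u) (mem_perp v) mem_Ann => /andP[/andP[/ker_dmulP[_ mx] /eqP hv] /eqP hu].
  have {}hu : ip one (a *c x).1 = 0.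
    by move: hu; rewrite /u (ip_adj _ _ _).1 cdconjK; case: (a *c x) => ? ?; rewrite /= ip0l addr0.
  have {}hv : ip one (a *c x).2 = 0.
    by move: hv; rewrite /v (ip_adj _ _ _).1 cdconjK ip_cdi.
  by move: mx; rewrite /dmul dpart_id // => ->.
have := dim_perp_ge v (ker_dmul a); have := dim_perp_ge u (perp v (ker_dmul a)); have := dimvS h.
lia.
Qed.

Definition split_add n (v : CD R n.+2) : CD R n.+1 := v.1 + J v.2.
Definition split_sub n (v : CD R n.+2) : CD R n.+1 := v.1 - J v.2.
Lemma split_add_linear n : linear (@split_add n).
Proof.
move=> k x y; rewrite /split_add -[(k *: x + y).1]/(k *: x.1 + y.1) -[(k *: x + y).2]/(k *: x.2 + y.2).
by rewrite JD JZ scalerDr addrACA.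
Qed.
Lemma split_sub_linear n : linear (@split_sub n).
Proof.
move=> k x y; rewrite /split_sub -[(k *: x + y).1]/(k *: x.1 + y.1) -[(k *: x + y).2]/(k *: x.2 + y.2).
by rewrite JD JZ scalerDr opprD scalerN addrACA.
Qed.
Lemma split_eq0 n (v : CD R n.+2) : split_add v = 0 -> split_sub v = 0 -> v = 0.
Proof.
case: v => c d; rewrite /split_add /split_sub /= => h1 h2.
have hc : c = 0.
  by apply: (@ip_ext R n.+1) => z; have := congr1 (@ip R _ ^~ z) h1; have := congr1 (@ip R _ ^~ z) h2; rewrite !ipE; lra.
have hd : d = 0.
  apply/eqP; rewrite -(ip_eq0 (d : CD R n.+1)) -ipJJ.
  by move: h1; rewrite hc add0r => ->; rewrite ip0l.
by rewrite hc hd.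
Qed.

Lemma ip_pair n (a b c d : CD R n) :
  ip ((a, b) : CD R n.+1) ((c, d) : CD R n.+1) = ip a c + ip b d.
Proof. by []. Qed.

(** The annihilated pairs with doubly pure entries. The entries of an annihilated
    pair are imaginary by [zd_imag_r], so that it suffices to impose
    orthogonality to i. *)
Definition pureAnn n (x : CD R n.+2) : {vspace CD R n.+2} :=
  perp ((cdi R n, 0) : CD R n.+2) (perp ((0, cdi R n) : CD R n.+2) (Ann x)).

Lemma dim_pureAnn n (x : CD R n.+2) : (\dim (Ann x) <= \dim (pureAnn x) + 2)%N.
Proof.
have := dim_perp_ge ((0, cdi R n) : CD R n.+2) (Ann x).
have := dim_perp_ge ((cdi R n, 0) : CD R n.+2) (perp ((0, cdi R n) : CD R n.+2) (Ann x)).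
rewrite -/(pureAnn x); lia.
Qed.

Lemma mem_pureAnn n (x : CD R n.+2) (c d : CD R n.+1) : x != 0 ->
  ((c, d) : CD R n.+2) \in pureAnn x ->
  [/\ pure2 c, pure2 d & x *c ((c, d) : CD R n.+2) = 0].
Proof.
move=> x0; rewrite !mem_perp mem_Ann => /andP[/andP[/eqP h /eqP hd] /eqP hc].
have [kc kd] := zd_imag_r h x0.
move: hc hd; rewrite !ip_pair !ip0l add0r addr0 !ip_cdi => hc hd.
move: kc kd; rewrite /= !ip0l !addr0 => kc kd.
by split.
Qed.

Section Step.
Variable n : nat.

(** By [split_mul] the coordinate x of an annihilated pair determines y, and y
    determines x. Moreover x cannot be an arbitrary doubly pure element: x = a
    gives a x = 0, hence y = 0 and then x = 0, and if a = 0 every x does so. *)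
Lemma dim_Ann_tilted (s t : R) (p q : CD R n.+1) : (0 < n)%N -> pure2 p -> pure2 q ->
  s ^+ 2 + t ^+ 2 != 0 ->
  (\dim (Ann ((s *: cdi R n + p, t *: cdi R n + q)%R : CD R n.+2)) < 2 ^ n.+1)%N.
Proof.
move=> n0 Dp Dq st0.
set x : CD R n.+2 := (s *: cdi R n + p, t *: cdi R n + q).
have x0 : x != 0.
  apply: contra st0 => /eqP /cdpair0[e1 e2].
  have f1 : s = 0.
    have := congr1 (ip (cdi R n)) e1; rewrite !ipE !ip_cdi (Dp.2) /= ip11; lra.
  have f2 : t = 0.
    have := congr1 (ip (cdi R n)) e2; rewrite !ipE !ip_cdi (Dq.2) /= ip11; lra.
  by rewrite f1 f2 expr2 mulr0 addr0.
have key c d : ((c, d) : CD R n.+2) \in pureAnn x -> [/\ pure2 c, pure2 d, 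
  dmul (p + J q) (c + J d) + (s *: J (c - J d) + t *: (c - J d)) = 0 &
  dmul (p - J q) (c - J d) + (s *: J (c + J d) - t *: (c + J d)) = 0].
  by move=> /(mem_pureAnn x0)[Dc Dd /split_mul[]//].
(* The operators s J + t and s J - t are invertible, since s and t do not
   both vanish. *)
have inv1 (y : CD R n.+1) : s *: J y + t *: y = 0 -> y = 0.
  move=> h; apply/eqP; rewrite -ip_eq0 -(mulrI_eq0 _ (mulfI st0)).
  have e1 := congr1 (ip y) h; have e2 := congr1 (ip (J y)) h.
  have e3 : ip y (J y) = - ip (J y) y by rewrite ipJ opprK.
  rewrite !ipE ipJJ in e1 e2; rewrite e3 in e1.
  apply/eqP.
  have -> : (s ^+ 2 + t ^+ 2) * ip y y = s * (s * ip y y + t * ip (J y) y)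
     + t * (s * - ip (J y) y + t * ip y y) by ring.
  by rewrite e1 e2 !mulr0 addr0.
have inv2 (y : CD R n.+1) : s *: J y - t *: y = 0 -> y = 0.
  move=> h; apply/eqP; rewrite -ip_eq0 -(mulrI_eq0 _ (mulfI st0)).
  have e1 := congr1 (ip y) h; have e2 := congr1 (ip (J y)) h.
  have e3 : ip y (J y) = - ip (J y) y by rewrite ipJ opprK.
  rewrite !ipE ipJJ in e1 e2; rewrite e3 in e1.
  apply/eqP.
  have -> : (s ^+ 2 + t ^+ 2) * ip y y = s * (s * ip y y - t * ip (J y) y)
     - t * (s * - ip (J y) y - t * ip y y) by ring.
  by rewrite e1 e2 !mulr0 subr0.
have m0 (y : CD R n.+1) : dmul y 0 = 0 by rewrite /dmul cdmulE dpart0.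
have dimX : \dim (linfun (@split_add n) @: pureAnn x) = \dim (pureAnn x).
  apply: limg_dim_eq; apply/eqP; rewrite -subv0; apply/subvP => -[c d].
  rewrite memv_cap memv_ker (linfunE (@split_add_linear n)) memv0 => /andP[/key[Dc Dd h1 _]].
  rewrite {1}/split_add /= => /eqP hX; rewrite hX m0 add0r in h1.
  by apply/eqP; apply: split_eq0 => //; exact: inv1.
have sub : (linfun (@split_add n) @: pureAnn x <= pure2v n)%VS.
  apply/subvP => _ /memv_imgP[[c d] /key[Dc Dd _ _] ->].
  rewrite (linfunE (@split_add_linear n)); apply/pure2vP; apply: pure2D => //; exact: pure2J.
have neq : (linfun (@split_add n) @: pureAnn x != pure2v n)%VS.
  apply/eqP => e.
  have onto z : pure2 z -> exists c d, [/\ pure2 c, pure2 d, z = c + J d,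
    dmul (p + J q) z + (s *: J (c - J d) + t *: (c - J d)) = 0 &
    dmul (p - J q) (c - J d) + (s *: J z - t *: z) = 0].
    move=> /pure2vP; rewrite -e => /memv_imgP[[c d] /key[Dc Dd h1 h2] ez].
    by exists c, d; rewrite ez (linfunE (@split_add_linear n)).
  have Da : pure2 (p + J q) by apply: pure2D => //; exact: pure2J.
  have zero z : pure2 z -> dmul (p + J q) z = 0 -> z = 0.
    move=> /onto[c [d [Dc Dd ez h1 h2]]] hm.
    rewrite hm add0r in h1; move: h2.
    by rewrite (inv1 _ h1) m0 add0r => /inv2.
  have a0 : p + J q = 0.
    apply: zero => //.
    by rewrite /dmul (sq_imag (pure2_imag Da)) dpartN dpartZ /dpart /= /impart ip11 ip0r !scale0r scale1r subr0 subrr scaler0 oppr0.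
  have [w [Dw w0]] : exists w : CD R n.+1, pure2 w /\ w != 0.
    exists (vpick (pure2v n)); split; first by apply/pure2vP; exact: memv_pick.
    rewrite vpick0 -dimv_eq0 -lt0n; have := dim_pure2v n.
    by rewrite !expnS -[in n in (2 ^ n)%N](prednK n0) expnS; have := expn_gt0 2 n.-1; lia.
  by move/eqP: w0; apply; apply: zero; rewrite // a0 /dmul cdmulE dpart0.
have := dim_pureAnn x; have := dim_pure2v n; rewrite -dimX.
have := (dimv_leqif_eq sub); move: neq => /negPf neq [le eqq].
rewrite neq in eqq; move/negbT: eqq; lia.
Qed.

(** The 6 counts the two components along i given up by [pureAnn] and the two
    dimensions allowed by [dim_ker_dmul] for each of the two coordinates. *)
Lemma dim_Ann_split (p q : CD R n.+1) : pure2 p -> pure2 q -> p + J q != 0 -> p - J q != 0 ->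
  (\dim (Ann ((p, q) : CD R n.+2)) <=
    \dim (Ann (p + J q)%R) + \dim (Ann (p - J q)%R) + 6)%N.
Proof.
move=> Dp Dq a0 b0; set x : CD R n.+2 := (p, q).
have x0 : x != 0.
  apply: contra a0 => /eqP /cdpair0[-> ->]; rewrite add0r /J /= oppr0 //.
have key c d : ((c, d) : CD R n.+2) \in pureAnn x -> 
  (split_add ((c, d) : CD R n.+2) \in ker_dmul (p + J q)) && (split_sub ((c, d) : CD R n.+2) \in ker_dmul (p - J q)).
  move=> /(mem_pureAnn x0)[Dc Dd h].
  have := @split_mul R n 0 0 p q c d Dp Dq Dc Dd; rewrite !scale0r !add0r => /(_ h).
  rewrite !subr0 !addr0 => -[h1 h2].
  by apply/andP; split; apply/ker_dmulP; split => //; apply: pure2D => //; do ?apply: pure2N; exact: pure2J.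
have := limg_ker_dim (linfun (@split_add n)) (pureAnn x).
have h1 : (linfun (@split_add n) @: pureAnn x <= ker_dmul (p + J q)%R)%VS.
  apply/subvP => _ /memv_imgP[[c d] /key/andP[h _] ->].
  by rewrite (linfunE (@split_add_linear n)).
set V := (_ :&: _)%VS.
have dimV : \dim (linfun (@split_sub n) @: V) = \dim V.
  apply: limg_dim_eq; apply/eqP; rewrite -subv0; apply/subvP => v.
  rewrite !memv_cap !memv_ker (linfunE (@split_add_linear n)) (linfunE (@split_sub_linear n)) memv0.
  by move=> /andP[/andP[_ /eqP hX] /eqP hY]; apply/eqP; exact: split_eq0.
have h2 : (linfun (@split_sub n) @: V <= ker_dmul (p - J q)%R)%VS.
  apply/subvP => _ /memv_imgP[[c d] hV ->].
  move: hV; rewrite memv_cap => /andP[/key/andP[_ h] _].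
  by rewrite (linfunE (@split_sub_linear n)).
have := dimvS h1; have := dimvS h2; have := dim_pureAnn x.
have := dim_ker_dmul (p + J q); have := dim_ker_dmul (p - J q).
rewrite dimV; lia.
Qed.

End Step.

End SmallAnnihilators.

(** * Elements with large annihilator *)

Section LargeAnnihilators.
Variable R : realType.

(** The analogue of p (i p) = |p|^2 i in an alternative algebra; here it holds
    because [dmulJr] kills the doubly pure part. *)
Lemma mul_J_self n (p : CD R n.+1) : pure2 p -> p *c J p = ip p p *: cdi R n.
Proof.
move=> Dp.
have h : dmul p (J p) = 0.
  rewrite dmulJr // /dmul (sq_imag (pure2_imag Dp)) dpartN dpartZ.
  by rewrite {1}/dpart /= /impart ip11 ip0r !scale0r scale1r subr0 subrr scaler0 oppr0; congr pair; rewrite /= !oppr0.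
have e1 : ip one (p *c J p).1 = 0.
  transitivity (ip one (p *c J p)); first by rewrite /= ip0l addr0.
  rewrite ip1M (pure2_conj (pure2J Dp)) ipNr.
  have := ipJ p p; rewrite ipC; lra.
have e2 : ip one (p *c J p).2 = ip p p.
  rewrite -ip_cdi ipC (ip_adj _ _ _).1 (pure2_conj Dp) cdmulE (mul_cdi Dp).2 opprK.
  by rewrite ipJJ.
rewrite /dmul in h.
have [h1 h2] := cdpair0 h.
rewrite [LHS]cdpair /cdi cdpairZ scaler0 -e2; congr pair.
  by move: h1; rewrite /impart e1 scale0r subr0.
by apply/eqP; rewrite -subr_eq0; apply/eqP.
Qed.

(** The orthogonal complement of the copy of the quaternions spanned by 1, i, p
    and i p, when p is doubly pure and nonzero. *)
Definition Hperp n (p : CD R n.+1) : {vspace CD R n.+1} :=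
  orthv [:: one; cdi R n; p; J p].

Lemma HperpP n (p c : CD R n.+1) :
  reflect [/\ pure2 c, ip p c = 0 & ip (J p) c = 0] (c \in Hperp p).
Proof.
rewrite -[Hperp p]/(perp one (perp (cdi R n) (orthv [:: p; J p]))) (mem_perp one) (mem_perp (cdi R n)).
rewrite mem_orthv ip_cdi -[all _ _]/((ip p c == 0) && ((ip (J p) c == 0) && true)) andbT.
have -> : ip one c = ip one c.1 by rewrite /= ip0l addr0.
apply: (iffP andP) => [[/andP[/andP[/eqP h1 /eqP h2] /eqP h3] /eqP h4]|[[-> ->] -> ->]].
  by split.
by rewrite eqxx.
Qed.

Lemma dim_Hperp n (p : CD R n.+1) : pure2 p -> p != 0 -> (\dim (Hperp p) + 4 = 2 ^ n.+1)%N.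
Proof.
move=> Dp p0; have Jp0 : J p != 0 by rewrite -ip_eq0 ipJJ ip_eq0.
apply: (@dim_orthv R n.+1 [:: one; cdi R n; p; J p]).
  have h : ip p (J p) = 0 by have := ipJ p p; rewrite ipC; lra.
  have h' : ip one (cdi R n) = 0 by rewrite ipC ip_cdi /= ip0r.
  rewrite /pairwise /all (pure2_imag Dp) (pure2_imag (pure2J Dp)) h h' !ip_cdi (Dp.2) (pure2J Dp).2.
  by rewrite eqxx.
apply/and5P; split=> //; first exact: one_neq0.
by rewrite -ip_eq0 ip_cdi ip11 oner_eq0.
Qed.

Lemma mul_J_Hperp n (p d : CD R n.+1) : pure2 p -> d \in Hperp p ->
  d *c J p = - (p *c J d).
Proof.
move=> Dp /HperpP[Dd k1 k2]; have DJp := pure2J Dp; have DJd := pure2J Dd.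
rewrite (anticomm (pure2_imag DJp) (pure2_imag Dd) k2).
have a1 : J p *c d = dmul (J p) d.
  by rewrite /dmul dpart_id //; apply: pure2_mul => //; rewrite ipJJ k1.
have a2 : p *c J d = dmul p (J d).
  rewrite /dmul dpart_id //; apply: pure2_mul => //; rewrite ?JJ ?ipNr ?k1 ?oppr0 //.
  by move: k2; rewrite ipJ; lra.
by rewrite a1 a2 dmulJl // dmulJr.
Qed.

(** For c and d in [Hperp p] the products with p and J p are doubly pure, so the
    split equations are the whole product. Conversely an annihilated pair is
    orthogonal to the image of the left multiplication by (p, - J p); four
    explicit elements of the image give orthogonality to p and J p, and the
    equations paired with p and J p give orthogonality to i, by [mul_J_self]. *)
Lemma Ann_halfP n (p c d : CD R n.+1) : pure2 p -> p != 0 ->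
  reflect [/\ c \in Hperp p, d \in Hperp p & p *c (c + J d) = 0]
    (((c, d) : CD R n.+2) \in Ann ((p, - J p) : CD R n.+2)).
Proof.
move=> Dp p0.
have Jp0 : J p != 0 by rewrite -ip_eq0 ipJJ ip_eq0.
have DJp := pure2J Dp.
have x0 : ((p, - J p) : CD R n.+2) != 0.
  by apply: contra p0 => /eqP/cdpair0[-> _].
rewrite mem_Ann; apply: (iffP eqP); last first.
  move=> [/HperpP[Dc h1 h2] /HperpP[Dd k1 k2] h].
  have D' := pure2J Dd.
  have jd : ip p (J d) = 0 by move: k2; rewrite ipJ; lra.
  have jc : ip p (J c) = 0 by move: h2; rewrite ipJ; lra.
  have e1 : d *c J p = - (p *c J d) by apply: mul_J_Hperp => //; apply/HperpP.
  have e2 : d *c p + J p *c c = - J (p *c (c + J d)).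
    rewrite (anticomm (pure2_imag Dp) (pure2_imag Dd) k1).
    have a1 : J p *c c = dmul (J p) c.
      by rewrite /dmul dpart_id //; apply: pure2_mul => //; rewrite ?ipJJ ?JJ ?ipNr ?k1 ?h1 ?oppr0.
    have a2 : p *c J d = dmul p (J d).
      by rewrite /dmul dpart_id //; apply: pure2_mul => //; rewrite ?ipJJ ?JJ ?ipNr ?k1 ?h1 ?oppr0.
    have a3 : p *c d = dmul p d by rewrite /dmul dpart_id //; apply: pure2_mul.
    have a4 : p *c c = dmul p c by rewrite /dmul dpart_id //; apply: pure2_mul.
    by rewrite cdmulE a1 a2 a3 a4 dmulJl // dmulJr // JD JN JJ opprK opprD addrC.
  have f1 : p *c c - d^c *c (- J p) = 0.
    by move: h; rewrite (pure2_conj Dd) cdmulNl cdmulNr e1 opprK opprK cdmulDr.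
  have f2 : d *c p + (- J p) *c c^c = 0.
    rewrite (pure2_conj Dc) cdmulNl cdmulNr opprK e2 h.
    by congr pair; rewrite /= !oppr0.
  by rewrite cdmulS f1 f2.
move=> h; have [hc hd] := zd_imag_r h x0.
(* Left multiplication by an imaginary element is antisymmetric. *)
have orth g : ip ((c, d) : CD R n.+2) (((p, - J p) : CD R n.+2) *c g) = 0.
  have x1 : ip one ((p, - J p) : CD R n.+2) = 0.
    by rewrite -[LHS]/(ip one p + ip 0 (- J p)) ip0l (pure2_imag Dp) addr0.
  have := congr1 (@ip R _ ^~ g) h; rewrite (ip_adj _ _ _).1 ip0l (imag_conj x1).
  by rewrite cdmulE ipNr => /eqP; rewrite oppr_eq0 => /eqP.
have i1 : (cdi R n)^c = - cdi R n by apply: imag_conj; rewrite ipC ip_cdi /= ip0r.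
have o1 := orth (cd1 R n.+2).
have o2 := orth ((0, cd1 R n.+1) : CD R n.+2).
have o3 := orth ((cdi R n, 0) : CD R n.+2).
have o4 := orth ((0, cdi R n) : CD R n.+2).
rewrite (cdmul1 _).2 ip_pair !ipE in o1.
rewrite cdmulS cdconj0 cdconj1 !cdmulE !cdmul1 ip_pair !ipE in o2.
rewrite cdmulS cdconj0 i1 !cdmulE (mul_cdi Dp).2 (mul_cdi DJp).2 JJ ip_pair !ipE in o3.
rewrite cdmulS cdconj0 i1 !cdmulE (mul_cdi Dp).1 (mul_cdi DJp).1 JJ ip_pair !ipE in o4.
have [f1 f2] : p *c c - d^c *c (- J p) = 0 /\ d *c p + (- J p) *c c^c = 0.
  by apply: cdpair0; rewrite -cdmulS.
rewrite (imag_conj hd) cdmulNl cdmulNr in f1.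
rewrite (imag_conj hc) cdmulNl cdmulNr in f2.
have pp0 : ip p p != 0 by rewrite ip_eq0.
have icz : ip (cdi R n) c = 0.
  apply: (mulfI pp0); rewrite mulr0 -ipZl -mul_J_self //.
  have a1 := congr1 (ip (J p)) f1.
  rewrite !ipE in a1.
  have a2 : ip (J p) (p *c c) = - ip (p *c J p) c.
    by rewrite ipC (ip_adj _ _ _).1 (pure2_conj Dp) cdmulE ipNr ipC.
  have a3 : ip (J p) (d *c J p) = 0.
    by rewrite ipC (ip_adj _ _ _).2 (mul_conj _).1 ipZr ipC hd mulr0.
  by rewrite a2 a3 in a1; lra.
have idz : ip (cdi R n) d = 0.
  apply: (mulfI pp0); rewrite mulr0 -ipZl -mul_J_self //.
  have a1 := congr1 (ip p) f1.
  rewrite !ipE in a1.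
  have a2 : ip p (p *c c) = 0.
    by rewrite ipC (ip_adj _ _ _).1 (mul_conj _).2 ipZr ipC hc mulr0.
  have a3 : ip p (d *c J p) = - ip (p *c J p) d.
    by rewrite ipC (ip_adj _ _ _).2 (pure2_conj DJp) cdmulE ipNr ipC.
  by rewrite a2 a3 in a1; lra.
have DU (z : CD R n.+1) : ip one z = 0 -> ip (cdi R n) z = 0 -> pure2 z.
  by rewrite ip_cdi /= ip0l addr0 => ? ?; split.
have Uc : c \in Hperp p.
  by apply/HperpP; split; [exact: DU | rewrite ipC; lra | rewrite ipC; lra].
have Ud : d \in Hperp p.
  by apply/HperpP; split; [exact: DU | rewrite ipC; lra | rewrite ipC; lra].
split=> //.
by rewrite cdmulDr -[p *c J d]opprK -mul_J_Hperp // -f1 opprK.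
Qed.

Lemma fst_linear n : linear (fun x : CD R n.+1 => x.1 : CD R n).
Proof. by []. Qed.

(** The coordinate c + J d maps the annihilator onto [Ann p], and its kernel
    consists of the pairs (c, J c) with c in [Hperp p]. *)
Lemma dim_Ann_half n (p : CD R n.+1) : pure2 p -> p != 0 ->
  (\dim (Ann ((p, - J p)%R : CD R n.+2)) + 4 = \dim (Ann p) + 2 ^ n.+1)%N.
Proof.
move=> Dp p0; set x : CD R n.+2 := (p, - J p).
have AU : (Ann p <= Hperp p)%VS.
  apply/subvP => z; rewrite mem_Ann => /eqP h; apply/HperpP; split.
  - exact: zd_pure2_r h p0.
  - have := congr1 (ip one) h; rewrite ip1M ip0r (pure2_conj (zd_pure2_r h p0)) ipNr; lra.
  - have := congr1 (ip (cdi R n)) h; rewrite ip0r ipC (ip_adj _ _ _).1 (pure2_conj Dp).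
    by rewrite cdmulE (mul_cdi Dp).2 opprK ipC.
have hX : (linfun (@split_add R n) @: Ann x)%VS = Ann p.
  apply/eqP; rewrite eqEsubv; apply/andP; split; apply/subvP => z.
    move=> /memv_imgP[[c d] /(Ann_halfP _ _ Dp p0)[_ _ h] ->].
    by rewrite (linfunE (@split_add_linear R n)) mem_Ann; apply/eqP.
  move=> zA; apply/memv_imgP; exists ((z, 0) : CD R n.+2).
    apply/(Ann_halfP _ _ Dp p0); split; rewrite ?mem0v //; first exact: (subvP AU).
    move: zA; rewrite mem_Ann => /eqP h; rewrite -[RHS]h; congr (_ *c _).
    by rewrite -[RHS]addr0; congr (_ + _); congr pair; rewrite /= oppr0.
  rewrite (linfunE (@split_add_linear R n)) /split_add /=.
  by rewrite -[LHS]addr0; congr (_ + _); congr pair; rewrite /= oppr0.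
have hK : (linfun (fun v : CD R n.+2 => v.1 : CD R n.+1) @: (Ann x :&: lker (linfun (@split_add R n))))%VS = Hperp p.
  apply/eqP; rewrite eqEsubv; apply/andP; split; apply/subvP => z.
    move=> /memv_imgP[[c d]]; rewrite memv_cap => /andP[/(Ann_halfP _ _ Dp p0)[h _ _] _] ->.
    by rewrite (linfunE (@fst_linear n.+1)).
  move=> zU; apply/memv_imgP; exists ((z, J z) : CD R n.+2); last first.
    by rewrite (linfunE (@fst_linear n.+1)).
  have e0 : z + J (J z) = 0 by rewrite JJ subrr.
  rewrite memv_cap memv_ker (linfunE (@split_add_linear R n)) [split_add _]e0 eqxx andbT.
  apply/(Ann_halfP _ _ Dp p0); split=> //; last by rewrite e0 cdmul0r.
  move/HperpP: zU => [Dz h1 h2]; apply/HperpP; split; first exact: pure2J.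
    by move: h2; rewrite ipJ; lra.
  by rewrite ipJJ.
have hI : (Ann x :&: lker (linfun (@split_add R n)) :&: lker (linfun (fun v : CD R n.+2 => v.1 : CD R n.+1)))%VS = 0%VS.
  apply/eqP; rewrite -subv0; apply/subvP => -[c d].
  rewrite !memv_cap !memv_ker (linfunE (@split_add_linear R n)) (linfunE (@fst_linear n.+1)) memv0.
  move=> /andP[/andP[_ /eqP h] /eqP /= c0]; apply/eqP; apply: split_eq0 => //.
  by move: h; rewrite /split_add /split_sub /= c0 !add0r => ->; rewrite oppr0.
have := limg_ker_dim (linfun (@split_add R n)) (Ann x).
rewrite hX -(limg_dim_eq hI) hK; have := dim_Hperp Dp p0.
set u := \dim (Hperp p); lia.
Qed.

(** The map (c, d) |-> (c, - d) is an automorphism of A_(n+1). *)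
Lemma Ann_flip n (p q : CD R n) :
  \dim (Ann ((p, - q) : CD R n.+1)) = \dim (Ann ((p, q) : CD R n.+1)).
Proof.
pose F (x : CD R n.+1) : CD R n.+1 := (x.1, - x.2).
have Fl : linear F by move=> k x y; congr pair; rewrite /= opprD scalerN.
have le (a b : CD R n) : (\dim (Ann ((a, b) : CD R n.+1)) <= \dim (Ann ((a, - b)%R : CD R n.+1)))%N.
  rewrite -(@limg_dim_eq _ _ _ (linfun F)); last first.
    apply/eqP; rewrite -subv0; apply/subvP => -[c d].
    rewrite memv_cap memv_ker (linfunE Fl) memv0 => /andP[_ /eqP/cdpair0[/= -> /eqP]].
    by rewrite oppr_eq0 => /eqP ->.
  apply/dimvS/subvP => _ /memv_imgP[[c d] h ->].
  rewrite (linfunE Fl) mem_Ann cdmulS /= cdconjN !cdmulE opprK.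
  move: h; rewrite mem_Ann cdmulS => /eqP/cdpair0[-> h].
  by rewrite -opprD h oppr0.
by apply/eqP; rewrite eqn_leq le andbT -{2}[q]opprK le.
Qed.

(** The bounds of [dim_Ann_tilted] and [dim_Ann_split] fall below d_(n+2) because
    4 (n + 1) <= 2^(n+1) and 14 < 4 (n + 1). *)
Lemma large_Ann_half n (x : CD R n.+2) : (3 <= n)%N ->
  (forall a : CD R n.+1, a != 0 -> (\dim (Ann a) <= 2 ^ n.+1 - 4 * n.+1 + 4)%N) ->
  x != 0 -> (2 ^ n.+2 - 4 * n.+2 + 4 <= \dim (Ann x))%N ->
  exists p, [/\ pure2 p, p != 0 & x = (p, - J p) \/ x = (p, J p)].
Proof.
move=> n3 IH x0 hx.
have big : (4 * n + 4 <= 2 ^ n.+1)%N.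
  by rewrite -(subnKC n3); elim: (n - 3)%N => // k; rewrite !addnS !expnS; lia.
have [y yx y0] : exists2 y, x *c y = 0 & y != 0.
  exists (vpick (Ann x)).
    by apply/eqP; rewrite -mem_Ann memv_pick.
  rewrite vpick0 -dimv_eq0 -lt0n; apply: leq_trans hx; rewrite !expnS in big *; lia.
have [p [q ex]] : exists p q : CD R n.+1, x = (p, q) by case: (x) => p q; exists p, q.
rewrite {x}ex in x0 hx yx *.
have [hp hq] := zd_imag yx y0.
have ep := imag_split hp; have eq := imag_split hq.
move: hx x0; rewrite {1 2}ep {1 2}eq.
set s := ip one p.2; set t := ip one q.2 => hx x0.
have Dp := pure2_dpart p; have Dq := pure2_dpart q.
have [st0|st] := eqVneq (s ^+ 2 + t ^+ 2) 0; last first.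
  exfalso; have := dim_Ann_tilted (ltnW (ltnW n3)) Dp Dq st.
  by move: (\dim _) hx => k hx; rewrite !expnS in big hx *; lia.
have s0 : s = 0.
  by apply/eqP; rewrite -sqrf_eq0; move: st0; have := sqr_ge0 s; have := sqr_ge0 t; move=> ? ? ?; apply/eqP; lra.
have t0 : t = 0.
  by apply/eqP; rewrite -sqrf_eq0; move: st0; have := sqr_ge0 s; have := sqr_ge0 t; move=> ? ? ?; apply/eqP; lra.
move: ep eq hx x0; rewrite -/s -/t s0 t0 !scale0r !add0r => ep eq.
rewrite -ep -eq in Dp Dq * => hx x0.
have p0 : p != 0 \/ q != 0.
  have [p0|] := eqVneq p 0; last by left.
  by right; apply: contra x0 => /eqP ->; rewrite p0.
have np : p + J q = 0 \/ p - J q = 0.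
  have [|a0] := eqVneq (p + J q) 0; first by left.
  have [|b0] := eqVneq (p - J q) 0; first by right.
  exfalso; have := dim_Ann_split Dp Dq a0 b0; have := IH _ a0; have := IH _ b0.
  move: (\dim _) (\dim _) (\dim _) hx => k1 k2 k3 hx.
  by rewrite !expnS in big hx *; lia.
exists p.
have pq : (p = J q \/ p = - J q).
  by case: np => /eqP; [rewrite addr_eq0 | rewrite subr_eq0] => /eqP; [right|left].
split=> //.
  case: p0 => //; apply: contra => /eqP e.
  have Jq0 : J q = 0.
    by case: pq; rewrite e => h; [rewrite -h | apply: oppr_inj; rewrite -h oppr0].
  by rewrite -ip_eq0 -ipJJ Jq0 ip0l.
by case: pq => ->; [left|right]; rewrite ?JN JJ ?opprK.
Qed.

End LargeAnnihilators.

(** * Octonions and sedenions *)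

Section Octonions.
Variable R : realType.

Lemma commS n : (forall x : CD R n, x^c = x) ->
  (forall x y : CD R n, x *c y = y *c x) ->
  forall x y : CD R n.+1, x *c y = y *c x.
Proof.
move=> hc hC [a b] [c d]; rewrite !cdmulS !hc (hC c a) (hC b d) (hC d a) (hC b c).
by rewrite (hC a d) (hC c b) (addrC (d *c a)).
Qed.

(** Reassociated, the eight triple products match up to the order of factors. *)
Lemma assocS n : (forall x y : CD R n, x *c y = y *c x) ->
  (forall x y z : CD R n, x *c y *c z = x *c (y *c z)) ->
  forall x y z : CD R n.+1, x *c y *c z = x *c (y *c z).
Proof.
move=> hC hA [a b] [c d] [e f]; rewrite !cdmulS.
rewrite !(cdmulE, cdconjD, cdconjN, cdconjM, cdconjK) -!hA.
have p3 (x y z : CD R n) : x *c y *c z = y *c z *c x by rewrite hA hC.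
have p2 (x y z : CD R n) : x *c y *c z = x *c z *c y by rewrite !hA (hC y).
rewrite (p3 a f^c d) (p3 c^c f^c b) (p3 e d^c b) (p2 f c a) (p2 d e^c a).
rewrite (p2 b e^c c^c) (p2 b d^c f) (p3 b f d^c).
by congr pair; apply: ip_ext => z; rewrite !ipE; ring.
Qed.

Lemma cdconjS n (a b : CD R n) : ((a, b) : CD R n.+1)^c = (a^c, - b).
Proof. by []. Qed.

(** In the product of (a, b)^* with (a, b) (c, d) the mixed terms cancel in pairs
    by associativity. *)
Lemma altS n : (forall x y z : CD R n, x *c y *c z = x *c (y *c z)) ->
  forall x y : CD R n.+1, x^c *c (x *c y) = ip x x *: y.
Proof.
move=> hA [a b] [c d].
have e1 : a^c *c (a *c c) = ip a a *: c.
  by rewrite -hA (mul_conj a).2 cdmulZl cdmul1.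
have e2 : c *c b^c *c b = ip b b *: c by rewrite hA (mul_conj b).2 cdmulZr cdmul1.
have e3 : d *c a *c a^c = ip a a *: d by rewrite hA (mul_conj a).1 cdmulZr cdmul1.
have e4 : b *c (b^c *c d) = ip b b *: d by rewrite -hA (mul_conj b).1 cdmulZl cdmul1.
rewrite ip_pair cdconjS !cdmulS.
rewrite !(cdmulE, cdconjD, cdconjN, cdconjM, cdconjK) e1 e2 e3 e4 !hA.
by rewrite cdpairZ; congr pair; apply: ip_ext => z; rewrite !ipE; ring.
Qed.

Lemma octonion_alt (x y : CD R 3) : x^c *c (x *c y) = ip x x *: y.
Proof.
have c0 (u v : CD R 0) : u *c v = v *c u by exact: (mulrC (u : R)).
have c1 : forall u v : CD R 1, u *c v = v *c u by apply: commS.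
have a0 (u v w : CD R 0) : u *c v *c w = u *c (v *c w).
  by rewrite /= mulrA.
by apply: altS; apply: assocS => //; apply: assocS.
Qed.

Section Alternative.
Variable n : nat.
Hypothesis altl : forall x y : CD R n, x^c *c (x *c y) = ip x x *: y.

Lemma altr (x y : CD R n) : y *c x *c x^c = ip x x *: y.
Proof.
have := altl x^c y^c; rewrite cdconjK ip_conj2 => /(congr1 (@cdconj R n)).
by rewrite !cdconjM !cdconjK cdconjZ cdconjK.
Qed.

Implicit Types x y z a b c d : CD R n.

Lemma ip_mull x y z : ip (x *c y) (x *c z) = ip x x * ip y z.
Proof. by rewrite (ip_adj _ _ _).1 altl ipZr. Qed.
Lemma ip_mulr x y z : ip (y *c x) (z *c x) = ip x x * ip y z.
Proof. by rewrite (ip_adj _ _ _).2 altr ipZr. Qed.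

Lemma mul_imag_sq x y : ip one x = 0 -> y *c x *c x = - (ip x x *: y).
Proof. by move=> h; rewrite -altr imag_conj // cdmulE opprK. Qed.

Lemma mul_imag_polar x y z : ip one x = 0 -> ip one z = 0 ->
  y *c x *c z + y *c z *c x = - ((2 * ip x z) *: y).
Proof.
move=> hx hz.
have h : ip one (x + z) = 0 by rewrite ipDr hx hz addr0.
have := mul_imag_sq y h; rewrite !cdmulE (mul_imag_sq y hx) (mul_imag_sq y hz) => h1.
apply: ip_ext => t; have := congr1 (@ip R _ ^~ t) h1.
rewrite !ipE (ipC z x); lra.
Qed.

(** Write y = (c, d): the equations are a c = - d b and d a = b c. Since norms
    are multiplicative, they give |a| |c| = |d| |b| and |d| |a| = |b| |c|, whence
    |a| = |b|. Their conjugates c a = - b d and a d = c b give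
    <a, b> |c|^2 = <c a, c b> = - <b d, a d> = - <a, b> |d|^2. *)
Lemma double_zd (a b : CD R n) (y : CD R n.+1) : ((a, b) : CD R n.+1) != 0 -> y != 0 ->
  ((a, b) : CD R n.+1) *c y = 0 ->
  [/\ ip one a = 0, ip one b = 0, ip a b = 0 & ip a a = ip b b].
Proof.
move=> x0 y0 h.
have [ha hb] := zd_imag h y0.
have [c [d ey]] : exists c d : CD R n, y = (c, d) by case: (y) => c d; exists c, d.
rewrite {y}ey in y0 h.
have [hc hd] := zd_imag_r h x0.
move: h; rewrite cdmulS (imag_conj hc) (imag_conj hd) !cdmulE opprK => /cdpair0[f1 f2].
have {}f1 : a *c c = - (d *c b) by apply/eqP; rewrite -addr_eq0 f1.
have {}f2 : d *c a = b *c c by apply/eqP; rewrite -subr_eq0 f2.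
have CD0 : ip c c + ip d d != 0 by rewrite (ip_eq0 ((c, d) : CD R n.+1)).
have g1 : c *c a = - (b *c d).
  have := congr1 (@cdconj R n) f1.
  by rewrite cdconjN !cdconjM (imag_conj ha) (imag_conj hb) (imag_conj hc) (imag_conj hd) !cdmulE !opprK.
have g2 : a *c d = c *c b.
  have := congr1 (@cdconj R n) f2.
  by rewrite !cdconjM (imag_conj ha) (imag_conj hb) (imag_conj hc) (imag_conj hd) !cdmulE !opprK.
split=> //.
  by apply: (mulfI CD0); rewrite mulr0 mulrDl -ip_mull g1 -g2 ipNl ip_mulr (ipC b) addNr.
have n1 := ip_mull a c c; have n2 := ip_mull d b b; have n3 := ip_mull d a a; have n4 := ip_mull b c c.
rewrite f1 ipNl ipNr opprK n2 in n1; rewrite f2 n4 in n3.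
by apply: (mulfI CD0); lra.
Qed.

(** The first entry c of an annihilated pair determines the second one,
    (a c) b / |b|^2, and it ranges over the orthogonal complement of the copy of
    the quaternions spanned by 1, a, b and a b. *)
Lemma dim_Ann_double (a b : CD R n) : a != 0 ->
  ip one a = 0 -> ip one b = 0 -> ip a b = 0 -> ip a a = ip b b ->
  \dim (Ann ((a, b) : CD R n.+1)) = (2 ^ n - 4)%N.
Proof.
move=> a0 ha hb hab hn.
have N0 : ip b b != 0 by rewrite -hn ip_eq0.
have x0 : ((a, b) : CD R n.+1) != 0 by apply: contra a0 => /eqP/cdpair0[-> _].
have ab1 : ip one (a *c b) = 0 by rewrite ip1M imag_conj // ipNr hab oppr0.
have nab : ip (a *c b) (a *c b) = ip b b * ip b b by rewrite ip_mull hn.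
set V := orthv [:: one; a; b; a *c b].
have dV : (\dim V + 4 = 2 ^ n)%N.
  apply: (@dim_orthv R n [:: one; a; b; a *c b]).
    have h1 : ip a (a *c b) = 0 by rewrite ipC (ip_adj _ _ _).1 (mul_conj _).2 ipZr ipC hb mulr0.
    have h2 : ip b (a *c b) = 0 by rewrite ipC (ip_adj _ _ _).2 (mul_conj _).1 ipZr ipC ha mulr0.
    by rewrite /pairwise /all ha hb ab1 hab h1 h2 eqxx.
  apply/and5P; split=> //; first exact: one_neq0.
    by rewrite -ip_eq0.
  by rewrite -ip_eq0 nab mulf_neq0.
have memV c : reflect [/\ ip one c = 0, ip a c = 0, ip b c = 0 & ip (a *c b) c = 0] (c \in V).
  rewrite mem_orthv /all andbT.
  apply: (iffP and4P) => [[/eqP ? /eqP ? /eqP ? /eqP ?]|[-> -> -> ->]]; first by split.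
  by rewrite eqxx.
have fstl : linear (fun v : CD R n.+1 => v.1 : CD R n) by [].
pose f := linfun (fun v : CD R n.+1 => v.1 : CD R n).
have memA (v : CD R n.+1) : v \in Ann ((a, b) : CD R n.+1) ->
  exists c d : CD R n, [/\ v = (c, d), ip one c = 0, ip one d = 0,
    a *c c = - (d *c b) & d *c a = b *c c].
  rewrite mem_Ann => /eqP h.
  have [c [d ey]] : exists c d : CD R n, v = (c, d) by case: (v) => c d; exists c, d.
  rewrite {v}ey in h *; have [hc hd] := zd_imag_r h x0; exists c, d.
  move: h; rewrite cdmulS (imag_conj hc) (imag_conj hd) !cdmulE opprK => /cdpair0[f1 f2].
  by split=> //; apply/eqP; [rewrite -addr_eq0 f1 | rewrite -subr_eq0 f2].
have fA : (f @: Ann ((a, b) : CD R n.+1))%VS = V.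
  apply/eqP; rewrite eqEsubv; apply/andP; split; apply/subvP => z.
    move=> /memv_imgP[v /memA[c [d [-> hc hd f1 f2]]] ->]; rewrite (linfunE fstl) /=.
    have e1 : a *c c *c b = ip b b *: d by rewrite f1 cdmulNl mul_imag_sq // opprK.
    (* c is not yet known to be orthogonal to a, hence the second term. *)
    have e2 : a *c c *c a = ip a a *: c - (2 * ip a c) *: a.
      have : a *c c = - (c *c a) - (2 * ip a c) *: one.
        have := cdconjE (a *c c); rewrite ip1M cdconjM !imag_conj // !cdmulE opprK ipNr => ->.
        by apply: ip_ext => t; rewrite !ipE; ring.
      by move=> ->; rewrite !cdmulE (mul_imag_sq c ha) cdmul1 opprK.
    have e3 : ip b b *: (b *c c) = - (ip a a *: (c *c b)) + (2 * ip a c) *: (a *c b).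
      rewrite -f2 -cdmulZl -e1.
      have := mul_imag_polar (a *c c) hb ha; rewrite ipC hab mulr0 scale0r oppr0 => /eqP.
      by rewrite addr_eq0 => /eqP ->; rewrite e2 !cdmulE opprD opprK.
    have e4 : c *c b = - (b *c c) - (2 * ip b c) *: one.
      have := cdconjE (b *c c); rewrite ip1M cdconjM !imag_conj // !cdmulE opprK ipNr => ->.
      by apply: ip_ext => t; rewrite !ipE; ring.
    (* Comparing the components of e3 along 1 and along a b shows that c is
       orthogonal to b and to a. *)
    have e5 : ip b b * ip b c = 0.
      have := congr1 (ip one) e3; rewrite e4 hn !ipE ab1 ip11; lra.
    have bc : ip b c = 0 by apply: (mulfI N0); rewrite mulr0.
    have ac : ip a c = 0.
      have := congr1 (ip (a *c b)) e3; rewrite e4 bc hn !ipE nab => h.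
      have : ip a c * (ip b b * ip b b) = 0 by lra.
      by move/eqP; rewrite !mulf_eq0 !(negPf N0) !orbF => /eqP.
    apply/memV; split => //.
    have := congr1 (@ip R _ ^~ b) f1.
    rewrite ipNl (ip_adj d _ _).2 (mul_conj _).1 ipZr (ipC d) hd mulr0 oppr0.
    by rewrite (ip_adj _ _ _).1 imag_conj // cdmulE ipNr ipC; lra.
  move=> /memV[hc ac bc abc]; apply/memv_imgP.
  exists ((z, (ip b b)^-1 *: (a *c z *c b)) : CD R n.+1); last by rewrite (linfunE fstl).
  have acz : z *c a = - (a *c z) by apply: anticomm.
  have bcz : z *c b = - (b *c z) by apply: anticomm.
  have d1 : ip one ((ip b b)^-1 *: (a *c z *c b)) = 0.
    rewrite ipZr ip1M (imag_conj hb) ipNr (ip_adj _ _ _).1 (imag_conj ha) cdmulE ipNr ipC abc.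
    by rewrite !oppr0 mulr0.
  rewrite mem_Ann cdmulS (imag_conj d1) (imag_conj hc) !cdmulE opprK mul_imag_sq //.
  have e6 : a *c z *c b *c a = ip b b *: (b *c z).
    have := mul_imag_polar (a *c z) hb ha; rewrite ipC hab mulr0 scale0r oppr0 => /eqP.
    rewrite addr_eq0 => /eqP ->; rewrite -[a *c z]opprK -acz cdmulNl mul_imag_sq // !cdmulE !opprK bcz hn.
    by rewrite scalerN opprK.
  rewrite e6 scalerN !scalerA mulVf // !scale1r !subrr.
  exact: eqxx.
have hI : (Ann ((a, b) : CD R n.+1) :&: lker f = 0)%VS.
  apply/eqP; rewrite -subv0; apply/subvP => v; rewrite memv_cap memv_ker memv0.
  move=> /andP[/memA[c [d [-> hc hd f1 f2]]]]; rewrite (linfunE fstl) /= => /eqP c0.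
  have := mul_imag_sq d hb; rewrite -[d *c b]opprK -f1 c0 !(cdmulE, oppr0) => /eqP.
  by rewrite eq_sym oppr_eq0 scaler_eq0 (negPf N0) /= => /eqP ->.
by rewrite -(limg_dim_eq hI) fA; move: (\dim V) dV => k <-; rewrite addnK.
Qed.

End Alternative.

Lemma sedenion_zd (a b : CD R 3) : ((a, b) : CD R 4) != 0 ->
  (0 < \dim (Ann ((a, b) : CD R 4)))%N ->
  [/\ ip one a = 0, ip one b = 0, ip a b = 0 & ip a a = ip b b].
Proof.
move=> x0; rewrite lt0n dimv_eq0 -vpick0 => y0; apply: (double_zd octonion_alt x0 y0).
by apply/eqP; rewrite -mem_Ann memv_pick.
Qed.

End Octonions.

(** * Annihilators of maximal dimension *)

Section MaximalAnnihilators.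
Variable R : realType.

Lemma dim_Ann_sheet n (p : CD R n.+1) (b : bool) : pure2 p -> p != 0 ->
  (\dim (Ann ((p, if b then J p else - J p)%R : CD R n.+2)) + 4 =
    \dim (Ann p) + 2 ^ n.+1)%N.
Proof.
by move=> Dp p0; case: b; [rewrite -(Ann_flip p (J p))|]; exact: dim_Ann_half.
Qed.

Lemma four_le_exp k : (4 * k.+4 <= 2 ^ k.+4)%N.
Proof. by elim: k => // k; rewrite !expnS; lia. Qed.

(** The bound feeds the induction: [large_Ann_half] needs it one dimension lower,
    and [dim_Ann_sheet] then transfers it. *)
Lemma dim_bound k (x : CD R k.+4) : x != 0 ->
  (\dim (Ann x) <= 2 ^ k.+4 - 4 * k.+4 + 4)%N.
Proof.
elim: k x => [|k IH] x x0.
  have [a [b ex]] : exists a b : CD R 3, x = (a, b) by case: (x) => c d; exists c, d.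
  rewrite {x}ex in x0 *.
  have [|h] := posnP (\dim (Ann ((a, b) : CD R 4))); first by move=> ->.
  have [ha hb hab hn] := sedenion_zd x0 h.
  have a0 : a != 0.
    apply: contra x0 => /eqP a0; move: hn; rewrite a0 ip0l => /esym/eqP; rewrite ip_eq0 => /eqP -> //.
  by rewrite (dim_Ann_double (@octonion_alt R)).
rewrite leqNgt; apply/negP => h.
have [p [Dp p0 ex]] := @large_Ann_half R k.+3 x isT IH x0 (ltnW h).
have [b eb] : exists b : bool, x = (p, if b then J p else - J p).
  by case: ex; [exists false|exists true].
have := dim_Ann_sheet b Dp p0; rewrite -eb; have := IH p p0; have := four_le_exp k.
by move: h; rewrite !expnS; lia.
Qed.

Lemma Ann_scale n (k : R) (x : CD R n) : k != 0 -> Ann (k *: x) = Ann x.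
Proof.
move=> k0; apply/vspaceP => y.
by rewrite !mem_Ann cdmulZl scaler_eq0 (negPf k0).
Qed.

Lemma ZDP k n (x : CD R n) : ZD R k n x <-> ip x x = 1 /\ \dim (Ann x) = k.
Proof.
rewrite /ZD /= /cdnorm cdinnerE; split=> -[h <-]; split=> //; last by rewrite h sqrtr1.
by rewrite -[LHS]sqr_sqrtr ?ip_ge0 // h expr1n.
Qed.

Definition topdim n := (2 ^ n - 4 * n + 4)%N.

Lemma topdimS k : (topdim k.+1.+4 + 4 = topdim k.+4 + 2 ^ k.+4)%N.
Proof. by rewrite /topdim; have := four_le_exp k; rewrite !expnS; lia. Qed.

Lemma ZD_norm_neq0 k n (x : CD R n) : ZD R k n x -> x != 0.
Proof. by move/ZDP => [h _]; rewrite -ip_eq0 h oner_eq0. Qed.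

Lemma ZD_pure2 k (p : CD R k.+4) : ZD R (topdim k.+4) _ p -> pure2 p.
Proof.
move=> /ZDP[_ h]; apply: (@zd_pure2 R _ p (vpick (Ann p))).
  by apply/eqP; rewrite -mem_Ann memv_pick.
by rewrite vpick0 -dimv_eq0 h /topdim addn4.
Qed.

(** The factor restores the unit norm, since |(p, J p)|^2 = 2 |p|^2. *)
Lemma ZD_double k (p : CD R k.+4) (b : bool) : ZD R (topdim k.+4) _ p ->
  ZD R (topdim k.+1.+4) _ ((Num.sqrt 2)^-1 *: ((p, if b then J p else - J p) : CD R k.+1.+4)).
Proof.
move=> hp; have Dp := ZD_pure2 hp; have p0 := ZD_norm_neq0 hp.
have s20 : Num.sqrt 2 != 0 :> R by rewrite sqrtr_eq0 -ltNge ltr0n.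
move: hp => /ZDP[h1 h2]; apply/ZDP; rewrite Ann_scale ?invr_eq0 //; split.
  have -> : ip ((Num.sqrt 2)^-1 *: ((p, if b then J p else - J p) : CD R k.+1.+4))
    ((Num.sqrt 2)^-1 *: ((p, if b then J p else - J p) : CD R k.+1.+4)) = (Num.sqrt 2 ^+ 2)^-1 * (ip p p + ip p p).
    by rewrite !ipZl !ipZr mulrA -invfM -expr2 ip_pair; case: b; rewrite ?ipNl ?ipNr ?opprK ipJJ.
  by rewrite sqr_sqrtr // h1; field.
by have := dim_Ann_sheet b Dp p0; rewrite h2; have := topdimS k; lia.
Qed.

Lemma ZD_halve k (x : CD R k.+1.+4) : ZD R (topdim k.+1.+4) _ x ->
  exists (p : CD R k.+4) (b : bool),
  ZD R (topdim k.+4) _ p /\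
  x = (Num.sqrt 2)^-1 *: ((p, if b then J p else - J p) : CD R k.+1.+4).
Proof.
move=> hx; have x0 := ZD_norm_neq0 hx.
have s20 : Num.sqrt 2 != 0 :> R by rewrite sqrtr_eq0 -ltNge ltr0n.
move: hx => /ZDP[h1 h2].
have [|p [Dp p0 ex]] := @large_Ann_half R k.+3 x isT (@dim_bound k) x0; first by rewrite h2.
have [b eb] : exists b : bool, x = (p, if b then J p else - J p).
  by case: ex; [exists false|exists true].
exists (Num.sqrt 2 *: p), b; split.
  apply/ZDP; rewrite Ann_scale //; split; last first.
    by have := dim_Ann_sheet b Dp p0; rewrite -eb h2; have := topdimS k; lia.
  rewrite ipZl ipZr mulrA -expr2 sqr_sqrtr //; move: h1; rewrite eb ip_pair.
  by case: (b); rewrite ?ipNl ?ipNr ?opprK ipJJ; lra.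
rewrite eb cdpairZ; congr pair.
  by rewrite scalerA mulVf // scale1r.
by case: (b); rewrite JZ ?scalerN scalerA mulVf // scale1r.
Qed.

Lemma ZD_sedenionP (a b : CD R 3) : ZD R 4 4 ((a, b) : CD R 4) <->
  [/\ ip one a = 0, ip one b = 0, ip a b = 0, ip a a = 2^-1 & ip b b = 2^-1].
Proof.
split.
  move=> h; have x0 := ZD_norm_neq0 h; move: h => /ZDP[h1 h2].
  have [|ha hb hab hn] := sedenion_zd x0; first by rewrite h2.
  by move: h1; rewrite ip_pair => h1; split=> //; lra.
move=> [ha hb hab hn hm]; apply/ZDP; rewrite ip_pair hn hm; split; first by field.
have a0 : a != 0 by rewrite -ip_eq0 hn invr_eq0 pnatr_eq0.
by rewrite (dim_Ann_double (@octonion_alt R)) // hn hm.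
Qed.

End MaximalAnnihilators.

(** * Gluing a space from finitely many sheets *)

Section Sheets.
Variable R : realType.

Lemma row_continuous (X : topologicalType) m (F : X -> 'rV[R]_m) :
  (forall j, continuous (fun x => F x ord0 j)) -> continuous F.
Proof.
move=> h x U [P hP sPU].
have : \forall z \near x, forall i j, P i j (F z i j).
  apply: filter_forall => i; apply: filter_forall => j.
  by rewrite (ord1 i); apply: h; have := hP ord0 j.
by apply: filterS => z hz; apply: sPU.
Qed.

(** The sheet through x is the unique i with g i (f x) = x. It is locally
    constant because the finitely many conditions g j (f x) <> x are open. *)
Lemma homeomorphic_sheets (X : normedModType R) (Y : topologicalType)
  (A : set X) (B : set Y) (I : finType) (f : X -> Y) (g : I -> Y -> X) :
  continuous f -> (forall i, continuous (g i)) ->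
  (forall x, A x -> B (f x)) -> (forall i y, B y -> A (g i y)) ->
  (forall x, A x -> exists i, g i (f x) = x) ->
  (forall i y, B y -> f (g i y) = y) ->
  (forall i j y, B y -> g i y = g j y -> i = j) ->
  homeomorphic (set_type A) {i : I & set_type B}.
Proof.
move=> fC gC fAB gBA gf fg ginj.
have ex (x : set_type A) : {i | g i (f (val x)) = val x}.
  by apply: cid; apply: gf; exact: set_valP.
pose c x := projT1 (ex x).
have cP x : g (c x) (f (val x)) = val x := projT2 (ex x).
pose h (x : set_type A) : set_type B :=
  exist _ (f (val x)) (mem_set (fAB _ (set_valP x))).
pose F (x : set_type A) : {i : I & set_type B} := existT _ (c x) (h x).
pose k (i : I) (y : set_type B) : set_type A :=
  exist _ (g i (val y)) (mem_set (gBA i _ (set_valP y))).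
pose G (y : {i : I & set_type B}) : set_type A := k (projT1 y) (projT2 y).
have valC (T : topologicalType) (S : set T) :
  continuous (fun x : set_type S => val x) by exact: initial_continuous.
have hC : continuous h.
  apply: (@continuous_comp_initial _ (set_type A) Y (fun y : set_type B => val y)).
  by move=> x; apply: (@continuous_comp _ _ _ _ f); [exact: valC | exact: fC].
have kC i : continuous (k i).
  apply: (@continuous_comp_initial _ (set_type B) X (fun y : set_type A => val y)).
  by move=> x; apply: (@continuous_comp _ _ _ _ (g i)); [exact: valC | exact: gC].
have c_unique x i : g i (f (val x)) = val x -> i = c x.
  by move=> e; apply: ginj (fAB _ (set_valP x)) _; rewrite e cP.
have c_const (x : set_type A) : \forall z \near x, c z = c x.
  have FF : Filter (nbhs x) by exact: nbhs_filter.
  have hi i : \forall z \near x, i != c x -> g i (f (val z)) != val z.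
    have [->|ni] := eqVneq i (c x); first by apply: (@filterE _ _ FF) => z.
    have : \forall z \near x, g i (f (val z)) - val z != 0.
      apply: (@cvgr_neq0 _ _ _ (nbhs x) FF _ (g i (f (val x)) - val x)).
        apply: cvgB; last exact: valC.
        apply: (@continuous_comp _ _ _ (fun x : set_type A => f (val x)) (g i)); last exact: gC.
        by apply: (@continuous_comp _ _ _ _ f); [exact: valC | exact: fC].
      by rewrite subr_eq0; apply: contra ni => /eqP/c_unique ->.
    by apply: filterS => z; rewrite subr_eq0.
  have := filter_forall FF hi.
  apply: filterS => z hz; apply/eqP; apply: contraT => /hz.
  by rewrite cP eqxx.
exists F, G; split.
- move=> x.
  have e : \forall z \near x, existT (fun _ => set_type B) (c x) (h z) = F z.
    by apply: filterS (c_const x) => z ez; rewrite /F ez.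
  apply: cvg_trans; first exact: (near_eq_cvg e).
  apply: (@continuous_comp _ _ _ h (existT (fun _ => set_type B) (c x))); first exact: hC.
  exact: existT_continuous.
- by move=> [i y] U /(kC i y).
- by move=> x; apply: val_inj; exact: cP.
- move=> [i y]; have By := set_valP y.
  have e2 : h (k i y) = y by apply: val_inj; exact: (fg i _ By).
  have e1 : c (k i y) = i by apply/esym/c_unique; rewrite /= (fg i _ By).
  by rewrite /F /G /= e1 e2.
Qed.

End Sheets.

(** * The sheets of the space of zero divisors *)

Section ZeroDivisorSheets.
Variable R : realType.

Local Notation V2 := ('rV[R]_7 * 'rV[R]_7)%type.

Lemma continuous_fst n : continuous (fun x : CD R n.+1 => x.1 : CD R n).
Proof. by move=> x; exact: cvg_fst. Qed.
Lemma continuous_snd n : continuous (fun x : CD R n.+1 => x.2 : CD R n).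
Proof. by move=> x; exact: cvg_snd. Qed.
Lemma continuous_pair (X Y Z : topologicalType) (f : X -> Y) (g : X -> Z) :
  continuous f -> continuous g -> continuous (fun x => (f x, g x)).
Proof. by move=> fC gC x; apply: cvg_pair; [exact: fC | exact: gC]. Qed.
Lemma continuous_cdpair (X : topologicalType) n (f g : X -> CD R n) :
  continuous f -> continuous g ->
  continuous (fun x => (f x, g x) : CD R n.+1).
Proof. by move=> fC gC x; apply: cvg_pair; [exact: fC | exact: gC]. Qed.
Lemma continuous_scale (X : topologicalType) (V : normedModType R) (k : R) (f : X -> V) :
  continuous f -> continuous (fun x => k *: f x).
Proof. by move=> fC x; apply: cvgZr; exact: fC. Qed.
Lemma continuous_opp (X : topologicalType) (V : normedModType R) (f : X -> V) :
  continuous f -> continuous (fun x => - f x).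
Proof. by move=> fC x; apply: cvgN; exact: fC. Qed.

Definition oct_of_row (u : 'rV[R]_7) : CD R 3 :=
  (((0, u ord0 (inord 0)), (u ord0 (inord 1), u ord0 (inord 2))),
   ((u ord0 (inord 3), u ord0 (inord 4)), (u ord0 (inord 5), u ord0 (inord 6)))).

Definition row_of_oct (a : CD R 3) : 'rV[R]_7 :=
  \row_j nth 0 [:: a.1.1.2; a.1.2.1; a.1.2.2; a.2.1.1; a.2.1.2; a.2.2.1; a.2.2.2] j.

Lemma oct_of_row_continuous : continuous oct_of_row.
Proof.
have h (j : 'I_7) : continuous (fun u : 'rV[R]_7 => u ord0 j : CD R 0).
  by move=> u; exact: coord_continuous.
do ![apply: continuous_cdpair]; do ?[exact: h].
exact: (@cst_continuous _ (CD R 0)).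
Qed.

Lemma row_of_oct_continuous : continuous row_of_oct.
Proof.
apply: row_continuous => j.
have e : (fun x => row_of_oct x ord0 j) = (fun a : CD R 3 =>
  nth 0 [:: a.1.1.2; a.1.2.1; a.1.2.2; a.2.1.1; a.2.1.2; a.2.2.1; a.2.2.2] j).
  by apply/funext => x; rewrite mxE.
rewrite e {e}.
have c1 n m (f : CD R m -> CD R n.+1) : continuous f -> continuous (fun x => (f x).1).
  by move=> fC x; apply: (@continuous_comp _ _ _ f); [exact: fC | exact: continuous_fst].
have c2 n m (f : CD R m -> CD R n.+1) : continuous f -> continuous (fun x => (f x).2).
  by move=> fC x; apply: (@continuous_comp _ _ _ f); [exact: fC | exact: continuous_snd].
have c0 m : continuous (fun x : CD R m => x) by move=> x; exact: cvg_id.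
case: j => [[|[|[|[|[|[|[|j]]]]]]] hj] //=.
- exact: (c2 0%N 3%N _ (c1 1%N 3%N _ (c1 2%N 3%N _ (c0 3%N)))).
- exact: (c1 0%N 3%N _ (c2 1%N 3%N _ (c1 2%N 3%N _ (c0 3%N)))).
- exact: (c2 0%N 3%N _ (c2 1%N 3%N _ (c1 2%N 3%N _ (c0 3%N)))).
- exact: (c1 0%N 3%N _ (c1 1%N 3%N _ (c2 2%N 3%N _ (c0 3%N)))).
- exact: (c2 0%N 3%N _ (c1 1%N 3%N _ (c2 2%N 3%N _ (c0 3%N)))).
- exact: (c1 0%N 3%N _ (c2 1%N 3%N _ (c2 2%N 3%N _ (c0 3%N)))).
- exact: (c2 0%N 3%N _ (c2 1%N 3%N _ (c2 2%N 3%N _ (c0 3%N)))).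
Qed.

Lemma oct_of_rowK u : row_of_oct (oct_of_row u) = u.
Proof.
apply/rowP => j; rewrite mxE.
by case: j => [[|[|[|[|[|[|[|j]]]]]]] hj] //=; congr (u _ _); apply/val_inj; rewrite /= inordK.
Qed.

Lemma row_of_octK a : ip one a = 0 -> oct_of_row (row_of_oct a) = a.
Proof.
case: a => [[[a0 a1] [a2 a3]] [[a4 a5] [a6 a7]]] /= h.
rewrite /oct_of_row /row_of_oct !mxE !inordK //=; congr (((_, _), _), _).
move: h; rewrite mul1r !mul0r; lra.
Qed.

Lemma oct_of_rowZ k u : oct_of_row (k *: u) = k *: oct_of_row u.
Proof. by rewrite /oct_of_row !mxE; congr (((_, _), _), _); rewrite scaler0. Qed.

Lemma row_of_octZ k a : row_of_oct (k *: a) = k *: row_of_oct a.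
Proof.
have s1 n (x : CD R n.+1) : ((k *: x).1 = k *: x.1) * ((k *: x).2 = k *: x.2) by [].
have s0 (x : CD R 0) : k *: x = k * (x : R) by [].
apply/rowP => j; rewrite /row_of_oct !mxE !(s1 2%N) !(s1 1%N) !(s1 0%N) !s0.
by case: j => [[|[|[|[|[|[|[|j]]]]]]] hj].
Qed.

Lemma ip_oct_of_row u v : ip (oct_of_row u) (oct_of_row v) = dotv u v.
Proof.
rewrite /dotv (eq_bigr (fun i : 'I_7 => u ord0 (inord i) * v ord0 (inord i))); last first.
  by move=> i _; rewrite inord_val.
rewrite -(big_mkord xpredT (fun i => u ord0 (inord i) * v ord0 (inord i))).
rewrite unlock /= mul0r; ring.
Qed.

Lemma oct_of_row_imag u : ip one (oct_of_row u) = 0.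
Proof. by rewrite /= mul1r !mul0r !addr0. Qed.

(** The premises of [homeomorphic_sheets] for the zero divisors of A_(k+4), with
    [f] and [g] defined on the ambient vector spaces so that they compose along
    the doubling. *)
Definition sheeted k (I : finType) (f : CD R k.+4 -> V2) (g : I -> V2 -> CD R k.+4) :=
  [/\ continuous f /\ (forall i, continuous (g i)),
   forall x, ZD R (topdim k.+4) k.+4 x -> Stiefel2 R 7 (f x),
   forall i y, Stiefel2 R 7 y -> ZD R (topdim k.+4) k.+4 (g i y),
   forall x, ZD R (topdim k.+4) k.+4 x -> exists i, g i (f x) = x &
   (forall i y, Stiefel2 R 7 y -> f (g i y) = y) /\
   (forall i j y, Stiefel2 R 7 y -> g i y = g j y -> i = j)].

Local Notation s2 := (Num.sqrt 2 : R).
Lemma s2_neq0 : s2 != 0.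
Proof. by rewrite sqrtr_eq0 -ltNge ltr0n. Qed.
Lemma s2K (V : lmodType R) (x : V) : (s2 *: (s2^-1 *: x) = x) * (s2^-1 *: (s2 *: x) = x).
Proof. by rewrite !scalerA mulfV ?mulVf ?s2_neq0 ?scale1r. Qed.

Lemma sheeted0 : exists (f : CD R 4 -> V2) (g : unit -> V2 -> CD R 4),
  @sheeted 0 unit f g.
Proof.
(* The entries of a zero divisor of norm 1 have norm 1 / sqrt 2. *)
exists (fun x => (s2 *: row_of_oct x.1, s2 *: row_of_oct x.2)).
exists (fun _ y => (s2^-1 *: oct_of_row y.1, s2^-1 *: oct_of_row y.2)).
have s22 : s2 * s2 = 2 by rewrite -expr2 sqr_sqrtr.
have sv : s2^-1 * s2^-1 = 2^-1 by rewrite -invfM s22.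
have ipI (a b : CD R 3) : ip one a = 0 -> ip one b = 0 ->
    dotv (s2 *: row_of_oct a) (s2 *: row_of_oct b) = 2 * ip a b.
  move=> ha hb; rewrite -ip_oct_of_row !oct_of_rowZ !ipZl !ipZr !row_of_octK // mulrA s22 //.
split.
- split.
    apply: (@continuous_pair (CD R 4) _ _ (fun x => s2 *: row_of_oct x.1) (fun x => s2 *: row_of_oct x.2)).
      apply: (@continuous_scale _ _ _ (fun x : CD R 4 => row_of_oct x.1)) => z.
      by apply: (@continuous_comp _ _ _ _ row_of_oct); [exact: continuous_fst | exact: row_of_oct_continuous].
    apply: (@continuous_scale _ _ _ (fun x : CD R 4 => row_of_oct x.2)) => z.
    by apply: (@continuous_comp _ _ _ _ row_of_oct); [exact: continuous_snd | exact: row_of_oct_continuous].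
  move=> _; apply: continuous_cdpair.
    apply: (@continuous_scale _ _ _ (fun y : V2 => oct_of_row y.1)) => z.
    by apply: (@continuous_comp _ _ _ _ oct_of_row); [exact: cvg_fst | exact: oct_of_row_continuous].
  apply: (@continuous_scale _ _ _ (fun y : V2 => oct_of_row y.2)) => z.
  by apply: (@continuous_comp _ _ _ _ oct_of_row); [exact: cvg_snd | exact: oct_of_row_continuous].
- move=> [a b] /ZD_sedenionP[ha hb hab hn hm]; split; rewrite /= ipI // ?hab ?hn ?hm ?mulr0 //; by rewrite mulfV // pnatr_eq0.
- move=> _ [u v] [/= hu hv huv].
  apply: (ZD_sedenionP (s2^-1 *: oct_of_row u) (s2^-1 *: oct_of_row v)).2.
  by rewrite !ipZl !ipZr !oct_of_row_imag !ip_oct_of_row hu hv huv !mulrA sv !mulr1 !mulr0.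
- move=> [a b] /ZD_sedenionP[ha hb hab hn hm]; exists tt.
  by rewrite /= !oct_of_rowZ !s2K !row_of_octK.
- split; last by move=> [] [].
  by move=> _ [u v] _; rewrite /= !row_of_octZ !s2K !oct_of_rowK.
Qed.

Lemma continuous_J n : continuous (@J R n).
Proof. by apply: continuous_cdpair; [exact: continuous_snd | apply: continuous_opp; exact: continuous_fst]. Qed.

(** The sheet index acquires one bit, the sign in (p, J p) and (p, - J p). *)
Lemma sheetedS k (I : finType) f g : @sheeted k I f g ->
  exists f' g', @sheeted k.+1 (bool * I)%type f' g'.
Proof.
move=> [[fC gC] fS gZ gf [fg ginj]].
pose G (b : bool) (p : CD R k.+4) : CD R k.+1.+4 :=
  s2^-1 *: ((p, if b then J p else - J p) : CD R k.+1.+4).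
have G1 b p : s2 *: (G b p).1 = p by rewrite /G cdpairZ /= (s2K _).1.
have GC b : continuous (G b).
  apply: continuous_scale; apply: continuous_cdpair; first by move=> x; exact: cvg_id.
  by case: b; [|apply: continuous_opp]; exact: continuous_J.
exists (fun x => f (s2 *: x.1)), (fun i y => G i.1 (g i.2 y)).
split.
- split.
    move=> x; apply: (@continuous_comp _ _ _ (fun x : CD R k.+1.+4 => s2 *: x.1) f); last exact: fC.
    by apply: (@continuous_scale _ _ _ (fun x : CD R k.+1.+4 => x.1)); exact: continuous_fst.
  by move=> [b i] y; apply: (@continuous_comp _ _ _ (g i)); [exact: gC | exact: GC].
- by move=> x /ZD_halve[p [b [hp ->]]]; rewrite -/(G b p) G1; exact: fS.
- by move=> [b i] y hy; apply: ZD_double; exact: gZ.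
- move=> x /ZD_halve[p [b [hp ->]]]; rewrite -/(G b p) G1.
  by have [i hi] := gf _ hp; exists (b, i); rewrite /= hi.
- split; first by move=> [b i] y hy; rewrite G1; exact: fg.
  move=> [b i] [c j] y hy /= h.
  have e : g i y = g j y by rewrite -(G1 b (g i y)) h G1.
  have ij := ginj _ _ _ hy e; rewrite -{j}ij in h e *.
  congr pair; apply/eqP/negPn/negP => bc.
  have p0 := ZD_norm_neq0 (gZ i y hy).
  have : J (g i y) = - J (g i y).
    have := congr1 (fun x : CD R k.+1.+4 => s2 *: x.2) h.
    rewrite /G !cdpairZ /= !s2K.
    by case: (b) (c) bc => [] [].
  move=> e2; move: p0; rewrite -ip_eq0 -ipJJ => /eqP; apply.
  by have := congr1 (ip (J (g i y))) e2; rewrite ipNr; lra.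
Qed.

Lemma sheetedE k : exists (I : finType) f g, #|I| = (2 ^ k)%N /\ @sheeted k I f g.
Proof.
elim: k => [|k [I [f [g [cI h]]]]].
  by have [f [g h]] := sheeted0; exists unit, f, g; rewrite card_unit.
have [f' [g' h']] := sheetedS h.
by exists (bool * I)%type, f', g'; rewrite card_prod card_bool cI expnS.
Qed.

End ZeroDivisorSheets.

(* [set_type] carries the subspace topology, and the sigma type the disjoint
   union topology. *)
Theorem theorem1p3 (R : realType) (n : nat) (hn : (4 <= n)%N) :
  homeomorphic
    (set_type (ZD R (2 ^ n - 4 * n + 4)%N n))
    {i : 'I_(2 ^ (n - 4)) & set_type (Stiefel2 R 7)}.
Proof.
have [k ->] : exists k, n = k.+4 by exists (n - 4)%N; lia.
have -> : (k.+4 - 4)%N = k by lia.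
have [I [f [g [cI [[fC gC] fS gZ gf [fg ginj]]]]]] := sheetedE R k.
pose e (i : 'I_(2 ^ k)) : I := enum_val (cast_ord (esym cI) i).
apply: (@homeomorphic_sheets R (CD R k.+4) _ _ _ _ f (fun i => g (e i))).
- exact: fC.
- by move=> i; exact: gC.
- exact: fS.
- by move=> i y /(gZ (e i)).
- move=> x /gf[i hi]; exists (cast_ord cI (enum_rank i)).
  by rewrite /e cast_ordK enum_rankK.
- by move=> i y; exact: fg.
- move=> i j y hy /(ginj _ _ _ hy)/enum_val_inj; exact: cast_ord_inj.
Qed.
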